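(* For every integer $\ell\ge 2$ there exist constants $0<c_\ell\le C_\ell<\infty$, depending only on $\ell$, such that for every integer $n\ge 1$ and every choice of connected graphs $G_1,\dots,G_n$ with vertex set $\{1,\dots,\ell\}$, the cartesian product $G=G_1\times\cdots\times G_n$ satisfies $$c_\ell\,\log|V_G|\ \le\ t_{\mathrm{mix}}^{\mathrm{IP}}(G)\ \le\ C_\ell\,\log|V_G|,$$ where $t_{\mathrm{mix}}^{\mathrm{IP}}(G)$ is the total-variation mixing time of the interchange process on $G$.
   Context: Graphs are finite, undirected and simple; $V_G$ and $E_G$ denote the vertex and edge sets of $G$. The cartesian product $G_1\times\cdots\times G_n$ has vertex set $V_{G_1}\times\cdots\times V_{G_n}$, and the neighbors of $x=(x_1,\dots,x_n)$ are obtained by replacing one arbitrary coordinate $x_i$ by an arbitrary neighbor of $x_i$ in $G_i$. So here $|V_G|=\ell^n$. For a finite connected graph $G$, the interchange process on $G$ is the continuous-time Markov chain $(\xi_t)_{t\ge 0}$ on the symmetric group $\mathfrak{S}(V_G)$ with $\xi_0=\mathrm{id}$ and generator $$\mathcal{L}^{\mathrm{IP}}_G f(\sigma)=\sum_{e\in E_G}\big(f(\sigma\tau_e)-f(\sigma)\big),\qquad f:\mathfrak{S}(V_G)\to\mathbb{R},$$ where $\tau_e$ is the transposition of the endpoints of $e$. Its mixing time is $$t_{\mathrm{mix}}^{\mathrm{IP}}(G)=\min\Big\{t\ge 0:\ \max_{A\subseteq\mathfrak{S}(V_G)}\big|\mathbb{P}(\xi_t\in A)-\mathbb{P}(\xi_\star\in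 A)\big|\le \tfrac1e\Big\},$$ where $\xi_\star$ is a uniform random element of $\mathfrak{S}(V_G)$. *)

(* Defs.v *)
From HB Require Import structures.
From mathcomp Require Import all_boot all_order all_algebra all_fingroup.
From mathcomp Require Import all_classical all_reals all_analysis.

Set Implicit Arguments.
Unset Strict Implicit.
Unset Printing Implicit Defensive.

Import Order.TTheory GRing.Theory Num.Theory.
Import numFieldNormedType.Exports.

Local Open Scope ring_scope.

Record sgraph (V : finType) := SGraph {
  adj :> rel V;
  adj_sym : symmetric adj;
  adj_irr : irreflexive adj }.

Definition edges (V : finType) (G : sgraph V) : {set {set V}} :=
  [set [set p.1; p.2] | p : V * V & G p.1 p.2].

Definition connected_graph (V : finType) (G : sgraph V) : Prop :=
  forall x y : V, connect G x y.

Section CartesianProduct.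
Variables (n : nat) (V : finType) (G : 'I_n -> sgraph V).

Definition cartprod_adj : rel {ffun 'I_n -> V} :=
  fun x y => [exists i, G i (x i) (y i) && [forall (j | j != i), x j == y j]].

Lemma cartprod_adj_sym : symmetric cartprod_adj.
Proof.
have sub x y : cartprod_adj x y -> cartprod_adj y x.
  case/existsP => i /andP[xyi /forallP xyj]; apply/existsP; exists i.
  rewrite adj_sym xyi /=; apply/forallP => j.
  by rewrite (eq_sym (y j)); apply: xyj.
by move=> x y; apply/idP/idP; apply: sub.
Qed.

Lemma cartprod_adj_irr : irreflexive cartprod_adj.
Proof. by move=> x; apply/existsP => -[i]; rewrite adj_irr. Qed.

Definition cartprod : sgraph {ffun 'I_n -> V} :=
  SGraph cartprod_adj_sym cartprod_adj_irr.

End CartesianProduct.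

(* The transposition of the endpoints of e, for e a two-element set
   (see edge_tpermE); the identity on other sets. *)
Definition edge_tperm (V : finType) (e : {set V}) : {perm V} :=
  if [pick p : V * V | e == [set p.1; p.2]] is Some p then tperm p.1 p.2
  else 1%g.

Lemma edge_tpermE (V : finType) (x y : V) :
  edge_tperm [set x; y] = tperm x y.
Proof.
rewrite /edge_tperm; case: pickP => [[a b] /= /eqP/setP E|/(_ (x, y))];
  last by rewrite eqxx.
move: (E x) (E y) (E a) (E b); rewrite !inE !eqxx ?orbT /=.
move=> /esym/orP[]/eqP-> /esym/orP[]/eqP->; rewrite ?orbb //=.
- by move=> _ /eqP->.
- by rewrite tpermC.
- by move=> /eqP->.
Qed.

Section Interchange.
Variables (R : realType) (V : finType) (G : sgraph V).

(* Permutation products are read from left to right in fingroup, so that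
   edge_tperm e * s is the composition "edge_tperm e first, then s", usually
   written s \o edge_tperm e. *)
Definition ip_gen (f : {perm V} -> R) : {perm V} -> R :=
  fun s => \sum_(e in edges G) (f (edge_tperm e * s)%g - f s).

(* exp(tL) f, where exp(tL) is the sum of the series of the t^k L^k / k!. *)
Definition expgen (S : finType) (L : (S -> R) -> (S -> R)) (t : R)
    (f : S -> R) : S -> R :=
  fun s => limn [series t ^+ k / k`!%:R * iter k L f s]_k.

(* The law at time t of the Markov chain with generator L started at s0:
   E [f (xi_t)] = (exp(tL) f)(s0), applied to the indicator of A. *)
Definition chain_law (S : finType) (L : (S -> R) -> (S -> R)) (s0 : S) (t : R)
    (A : {set S}) : R :=
  expgen L t (fun s => (s \in A)%:R) s0.

Definition uniform_law (S : finType) (A : {set S}) : R := #|A|%:R / #|S|%:R.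

Definition dTV (S : finType) (P Q : {set S} -> R) : R :=
  \big[Num.max/0]_(A : {set S}) `|P A - Q A|.

Definition ip_law : R -> {set {perm V}} -> R := chain_law ip_gen 1%g.

Definition ip_mixed : set R :=
  [set t | 0 <= t /\ dTV (ip_law t) (@uniform_law _) <= expR (- 1)]%classic.

(* A minimum whenever some time is mixed, by tmixIP_min below; inf set0 = 0. *)
Definition tmixIP : R := inf ip_mixed.

Local Open Scope classical_set_scope.

Let M : R := (2 * #|edges G|)%:R.

Lemma ip_iter_bound (f : {perm V} -> R) (b : R) :
  (forall s, `|f s| <= b) ->
  forall k s, `|iter k ip_gen f s| <= M ^+ k * b.
Proof.
move=> fb; elim=> [|k IH] s; first by rewrite expr0 mul1r.
rewrite iterS /ip_gen; apply: (le_trans (ler_norm_sum _ _ _)).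
apply: (@le_trans _ _ (\sum_(e in edges G) (M ^+ k * b) *+ 2)).
  apply: ler_sum => e _; apply: (le_trans (ler_normB _ _)).
  by rewrite mulr2n lerD.
by rewrite sumr_const -mulrnA exprS -mulrA mulr_natl.
Qed.

Lemma is_cvg_expgen (f : {perm V} -> R) (t : R) (s : {perm V}) :
  cvgn [series t ^+ k / k`!%:R * iter k ip_gen f s]_k.
Proof.
pose b := \sum_s `|f s|.
have fb s' : `|f s'| <= b.
  by rewrite /b (bigD1 s') //= lerDl sumr_ge0.
apply: normed_cvg.
apply: (@series_le_cvg _ _ (fun k => exp_coeff (`|t| * M) k * b)) => [k|k|k|].
- exact: normr_ge0.
- by rewrite mulr_ge0 ?exp_coeff_ge0 ?mulr_ge0 // (le_trans _ (fb s)).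
- rewrite /= !normrM normfV normrX normr_nat /exp_coeff /= exprMn.
  rewrite mulrAC [leRHS]mulrAC ler_wpM2r ?invr_ge0 // -mulrA.
  by rewrite ler_wpM2l ?exprn_ge0 //; exact: ip_iter_bound.
have -> : series (fun k => exp_coeff (`|t| * M) k * b)
        = b *: series (exp_coeff (`|t| * M)) :> (R ^nat).
  rewrite funeqE => n; rewrite /series /= -mulr_suml mulrC //.
apply: is_cvgZl_tmp; exact: is_cvg_series_exp_coeff.
Qed.

Lemma expgen_continuous (f : {perm V} -> R) (s : {perm V}) :
  continuous (fun t => expgen ip_gen t f s).
Proof.
pose c g k : R := (k`!%:R)^-1 * iter k ip_gen g s.
have seriesE g t :
    [series t ^+ k / k`!%:R * iter k ip_gen g s]_k = pseries (c g) t.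
  by congr series; apply/funext => k /=; rewrite /c -mulrA mulrC.
have cvgc g t : cvgn (pseries (c g) t).
  by rewrite -seriesE; exact: is_cvg_expgen.
have dE g : pseries_diffs (c g) = c (ip_gen g).
  apply/funext => k; rewrite /pseries_diffs /c -iterSr factS natrM invfM !mulrA.
  by rewrite divff ?pnatr_eq0 // mul1r.
move=> t.
have tt1 : `|t| < `| `|t| + 1|.
  by rewrite (@ger0_norm _ (`|t| + 1)) ?ltrDl // addr_ge0.
have [||||dt _] := @pseries_snd_diffs R (c f) (`|t| + 1) t; rewrite ?dE ?dE //.
have -> : (fun u => expgen ip_gen u f s) = (fun u => limn (pseries (c f) u)).
  by apply/funext => u; rewrite /expgen seriesE.
by apply: differentiable_continuous; apply/derivable1_diffP; exact: dt.
Qed.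

Lemma tmixIP_min (t : R) :
  ip_mixed t -> ip_mixed tmixIP /\ (forall u, ip_mixed u -> tmixIP <= u).
Proof.
move=> mt.
have lb0 : has_lbound ip_mixed by exists 0 => u [].
have mixedE : ip_mixed = [set u | 0 <= u] `&`
    \bigcap_(A in [set: {set {perm V}}])
      [set u | `|ip_law u A - @uniform_law _ A| <= expR (- 1)].
  apply/seteqP; split=> [u [u0 H]|u [u0 H]]; split => //.
    move=> A _ /=; apply: le_trans H.
    exact: (le_bigmax_cond _ (fun A => `|ip_law u A - @uniform_law _ A|)).
  apply/bigmax_leP; split; first exact: expR_ge0.
  by move=> A _; exact: (H A).
have cl : closed ip_mixed.
  rewrite mixedE; apply: closedI; first exact: closed_ge.
  apply: closed_bigI => A _.
  apply: (@preimage_closed _ _ (fun u => `|ip_law u A - uniform_law A|)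
    [set x | x <= expR (- 1)]); last exact: closed_le.
  move=> u _; apply: cvg_norm; apply: cvgB; last exact: cvg_cst.
  exact: expgen_continuous.
split; last by move=> u; exact: ge_inf.
have : closure ip_mixed (inf ip_mixed).
  move=> B /nbhs_ballP[e /= e0 eB].
  have hi : has_inf ip_mixed by split => //; exists t.
  have [u mu ue] := inf_adherent e0 hi.
  exists u; split=> //; apply: eB; rewrite /ball /= distrC ger0_norm.
    by rewrite ltrBlDl.
  by rewrite subr_ge0; exact: ge_inf.
by move/closure_id: cl => <-.
Qed.

End Interchange.

(* Main.v *)
Require Import Defs.
From mathcomp Require Import all_boot all_order all_algebra all_fingroup.
From mathcomp Require Import all_classical all_reals all_analysis ring lra zify.
Set Implicit Arguments.
Unset Strict Implicit.
Unset Printing Implicit Defensive.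
Import Order.TTheory GRing.Theory Num.Theory.
Import numFieldNormedType.Exports.
Local Open Scope ring_scope.

(* Upper bound.  The resampling energies E_S, which average the energy of the
   transpositions (x y) over y obtained from x by resampling the coordinates in
   S, satisfy E_{S u T} <= (1 + o(1)) (E_S + E_T) on average over many disjoint
   blocks: this is the octopus inequality for a star with equal weights, which
   follows from Young's rules for the joint spectrum of the Jucys-Murphy
   elements.  Doubling the blocks, the losses multiply to a constant, so the
   Dirichlet form of the complete graph, normalised by 1/|V|, is at most a
   constant times that of the product.  Functions on the symmetric group
   orthogonal to all functions of k - 1 coordinates form an invariant subspace
   on which the normalised complete-graph form is at least a multiple of k;
   the component of the point mass on functions of k coordinates has squared
   norm at most |V|^(2k) / |V|!.  Hence the L2 distance at time t is at most a
   geometric series in |V| exp(-lambda t).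

   Lower bound (Wilson's method).  An eigenfunction g of the Laplacian of the
   first factor gives the eigenfunction F(s) = sum_x g(x) g(s(x)) of the
   interchange process, whose variance stays O(|V|) while its mean starts at
   order |V| and decays at a rate bounded in terms of l. *)

(** * Self-adjoint operators on functions on a finite set *)

(** A spectral gap alone would not give the upper bound: relative to the uniform law the density of
    a point mass has squared L2 norm |V|!, so decay at a constant rate needs a time of order |V| log
    |V|. This is why the rate has to grow linearly with the level k. That growth is computed on the
    complete graph only and reaches the product through the Dirichlet form, so the spectrum of the
    product never has to be known.

    The obstacle in the comparison is the loss per doubling. The triangle inequality for swap
    energies has constant 6, and about log n doublings with such a loss would cost a power of n.
    With m = n/k blocks of size k the octopus inequality loses only m / (m - 1), that is 1 + O(k/n),
    and the sum of k/n over the powers of 2 up to n is bounded. As the factors may be different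
    graphs, energies are averaged over all permutations of the coordinates.

    Wilson's bound is void when |V| is below a constant depending on l; there the probability of not
    having jumped gives the lower bound. *)

Lemma continuous_sumr (R : realType) (T : topologicalType) (I : Type) (r : seq I)
    (F : I -> T -> R) :
  (forall i, continuous (F i)) -> continuous (fun x => \sum_(i <- r) F i x).
Proof.
move=> cF; elim: r => [|i r IH].
  under eq_fun do rewrite big_nil.
  by move=> x; exact: cvg_cst.
under eq_fun do rewrite big_cons.
by move=> x; apply: cvgD; [exact: cF|exact: IH].
Qed.

Section Dot.
Variables (R : realType) (S : finType).
Implicit Types (f g h : S -> R) (A : (S -> R) -> S -> R).

Definition dot f g : R := \sum_s f s * g s.
Definition dirac_fun (t : S) : S -> R := fun s => (s == t)%:R.
Definition lin A := forall a f g,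
  A (fun s => a * f s + g s) = fun s => a * A f s + A g s.
Definition selfadj A := forall f g, dot (A f) g = dot f (A g).
Definition orthc (W : (S -> R) -> Prop) f := forall w, W w -> dot f w = 0.

Lemma dotC f g : dot f g = dot g f.
Proof. by apply: eq_bigr => s _; rewrite mulrC. Qed.

Lemma dotDZl a f g h : dot (fun s => a * f s + g s) h = a * dot f h + dot g h.
Proof.
by rewrite /dot mulr_sumr -big_split; apply: eq_bigr => s _ /=; rewrite mulrDl mulrA.
Qed.

Lemma dotDZr a f g h : dot h (fun s => a * f s + g s) = a * dot h f + dot h g.
Proof. by rewrite dotC dotDZl !(dotC h). Qed.

Lemma dotZl a f h : dot (fun s => a * f s) h = a * dot f h.
Proof. by rewrite /dot mulr_sumr; apply: eq_bigr => s _ /=; rewrite mulrA. Qed.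

Lemma dotZr a f h : dot h (fun s => a * f s) = a * dot h f.
Proof. by rewrite dotC dotZl dotC. Qed.

Lemma dot0l h : dot (fun=> 0) h = 0.
Proof. by rewrite /dot big1 // => s _; rewrite mul0r. Qed.

Lemma dot_suml (I : Type) (r : seq I) (P : pred I) (F : I -> S -> R) h :
  dot (fun s => \sum_(i <- r | P i) F i s) h = \sum_(i <- r | P i) dot (F i) h.
Proof. by rewrite /dot exchange_big; apply: eq_bigr => s _; rewrite mulr_suml. Qed.

Lemma dot_sumr (I : Type) (r : seq I) (P : pred I) (F : I -> S -> R) h :
  dot h (fun s => \sum_(i <- r | P i) F i s) = \sum_(i <- r | P i) dot h (F i).
Proof. by rewrite dotC dot_suml; apply: eq_bigr => i _; rewrite dotC. Qed.

Lemma dot_ge0 f : 0 <= dot f f.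
Proof. by apply: sumr_ge0 => s _; rewrite -expr2 sqr_ge0. Qed.

Lemma dot_eq0 f : dot f f = 0 -> f = fun=> 0.
Proof.
move=> f0; apply/funext => s.
have /psumr_eq0P : forall s, true -> 0 <= f s * f s.
  by move=> ? _; rewrite -expr2 sqr_ge0.
by move=> /(_ f0 s isT)/eqP; rewrite mulf_eq0 orbb => /eqP.
Qed.

Lemma dot_gt0 f : f <> (fun=> 0) -> 0 < dot f f.
Proof.
by move=> f0; rewrite lt_neqAle dot_ge0 andbT eq_sym; apply/eqP => /dot_eq0.
Qed.

Lemma dot_dirac f t : dot f (dirac_fun t) = f t.
Proof.
rewrite /dot (bigD1 t) //= /dirac_fun eqxx mulr1 big1 ?addr0 // => s /negbTE ->.
by rewrite mulr0.
Qed.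

Lemma lin0 A : lin A -> A (fun=> 0) = fun=> 0.
Proof.
move=> /(_ (-1) (fun=> 0) (fun=> 0)).
have -> : (fun s : S => -1 * (0 : R) + 0) = fun=> 0.
  by apply/funext => s; rewrite mulr0 addr0.
move=> E; apply/funext => s; move: (congr1 (fun F => F s) E) => /= ->; ring.
Qed.

Lemma linZ A a f : lin A -> A (fun s => a * f s) = fun s => a * A f s.
Proof.
move=> lA; move: (lA a f (fun=> 0)); rewrite lin0 //.
have -> : (fun s => a * f s + 0) = fun s => a * f s.
  by apply/funext => s; rewrite addr0.
by move=> ->; apply/funext => s; rewrite addr0.
Qed.

Lemma lin_sum A (I : Type) (r : seq I) (P : pred I) (c : I -> R) (F : I -> S -> R) :
  lin A -> A (fun s => \sum_(i <- r | P i) c i * F i s)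
           = fun s => \sum_(i <- r | P i) c i * A (F i) s.
Proof.
move=> lA; elim: r => [|i r IH].
  under eq_fun do rewrite big_nil.
  by rewrite lin0 //; apply/funext => s; rewrite big_nil.
under eq_fun do rewrite big_cons.
under [RHS]eq_fun do rewrite big_cons.
by case: (P i) => //; rewrite lA IH.
Qed.

Lemma lin_dirac A f : lin A -> A f = fun s => \sum_t f t * A (dirac_fun t) s.
Proof.
move=> lA; rewrite -(lin_sum _ _ f (@dirac_fun) lA); congr A.
apply/funext => s; rewrite (bigD1 s) //= /dirac_fun eqxx mulr1.
by rewrite big1 ?addr0 // => t /negbTE; rewrite eq_sym => ->; rewrite mulr0.
Qed.

Lemma quad_linear_coef (b c : R) :
  (forall t, 0 <= t * b + t ^+ 2 * c) -> b = 0.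
Proof.
move=> H; apply/eqP; case: (eqVneq b 0) => // b0; exfalso.
have d0 : 0 < 1 + `|c| by rewrite ltr_pwDl.
(* At this t the linear term outweighs the quadratic one; the 1 keeps the denominator positive when
   [c] vanishes. *)
have := H (- b / (1 + `|c|)).
rewrite expr_div_n sqrrN -mulrA [_^-1 * b]mulrC mulrA mulNr -expr2.
have -> : - (b ^+ 2) / (1 + `|c|) + b ^+ 2 / (1 + `|c|) ^+ 2 * c
   = b ^+ 2 * ((c - (1 + `|c|)) / (1 + `|c|) ^+ 2).
  by field; rewrite gt_eqF.
rewrite pmulr_rge0; last by rewrite lt_neqAle sqr_ge0 eq_sym sqrf_eq0 b0.
rewrite pmulr_lge0 ?invr_gt0 ?exprn_gt0 // subr_ge0.
by move/(le_trans)/(_ (ler_norm c)); rewrite gerDr ler10.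
Qed.

Local Open Scope classical_set_scope.

(** Compactness of the unit sphere of [orthc W]: functions are encoded as row vectors, for which
    closed bounded sets are compact. The inequality is cross-multiplied so that it also covers the
    zero function. *)
Lemma rayleigh_min (W : (S -> R) -> Prop) A f0 :
  lin A -> selfadj A -> orthc W f0 -> f0 <> (fun=> 0) ->
  exists2 v, orthc W v /\ v <> (fun=> 0) &
    forall f, orthc W f -> dot (A v) v * dot f f <= dot (A f) f * dot v v.
Proof.
move=> lA sA Wf0 f00; pose n := #|S|.
pose F (c : 'rV[R]_n) : S -> R := fun s => c ord0 (enum_rank s).
pose C (f : S -> R) : 'rV[R]_n := \row_i f (enum_val i).
have CK f : F (C f) = f by apply/funext => s; rewrite /F mxE enum_rankK.
have contF s : continuous (fun c => F c s) by move=> c; exact: coord_continuous.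
have cont_sum (G : S -> 'rV[R]_n -> R) :
    (forall s, continuous (G s)) -> continuous (fun c => \sum_s G s c).
  exact: continuous_sumr.
have cont_dot (G H : 'rV[R]_n -> S -> R) : (forall s, continuous (fun c => G c s)) ->
    (forall s, continuous (fun c => H c s)) -> continuous (fun c => dot (G c) (H c)).
  by move=> cG cH; apply: cont_sum => s c; exact: (cvgM (cG s c) (cH s c)).
have contA s : continuous (fun c => A (F c) s).
  rewrite (_ : (fun c => _) = fun c => \sum_t F c t * A (dirac_fun t) s).
    by apply: cont_sum => t c; exact: (cvgM (contF t c) (cvg_cst _)).
  by apply/funext => c; rewrite [in LHS](lin_dirac _ lA).
pose K := [set c | dot (F c) (F c) = 1 /\ orthc W (F c)].
have [u [uW [u0 u1]]] : exists u, orthc W u /\ u <> (fun=> 0) /\ dot u u = 1.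
  exists (fun s => (Num.sqrt (dot f0 f0))^-1 * f0 s); split; [|split].
  - move=> w Ww; rewrite dotZl. by rewrite (Wf0 _ Ww) mulr0.
  - move=> E; apply: (f00); apply/funext => s.
    have /eqP := congr1 (fun G => G s) E; rewrite mulf_eq0 invr_eq0.
    have z0 : 0 < Num.sqrt (dot f0 f0) by rewrite sqrtr_gt0; exact: dot_gt0.
    by rewrite (gt_eqF z0) => /eqP.
  - by rewrite dotZl dotZr mulrA -invfM -expr2 sqr_sqrtr ?dot_ge0 // mulVf // gt_eqF //; exact: dot_gt0.
have K0 : K !=set0 by exists (C u); split; rewrite CK.
have clK : closed K.
  rewrite (_ : K = [set c | dot (F c) (F c) = 1] `&`
     \bigcap_(w in [set w | W w]) [set c | dot (F c) w = 0]); last first.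
    by apply/seteqP; split=> [c [H1 H2]|c [H1 H2]]; split => // w Ww; exact: H2.
  apply: closedI.
    apply: (@preimage_closed _ _ (fun c => dot (F c) (F c)) [set x | x = 1]).
      by move=> x _; exact: cont_dot.
    exact: closed_eq.
  apply: closed_bigI => w _.
  apply: (@preimage_closed _ _ (fun c => dot (F c) w) [set x | x = 0]).
    by move=> x _; apply: cont_dot => // s; exact: cst_continuous.
  exact: closed_eq.
have bK : bounded_set K.
  exists 1; split => // M M1 c [c1 _].
  rewrite /= [leLHS]/Num.norm /= mx_normrE; apply/bigmax_leP.
  split; first by rewrite ltW // (lt_trans ltr01).
  move=> [i j] _ /=; rewrite (ord1 i); apply/ltW/(le_lt_trans _ M1).
  rewrite -(@ler_sqr _ `|_| 1) ?nnegrE // expr1n -c1 real_normK ?num_real //.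
  rewrite /dot (bigD1 (enum_val j)) //= /F enum_valK -expr2 lerDl.
  by apply: sumr_ge0 => s _; rewrite -expr2 sqr_ge0.
have cK := bounded_closed_compact bK clK.
have [|c cin cmin] := @compact_EVT_min _ R (fun c => dot (A (F c)) (F c)) K K0 cK.
  by apply: continuous_subspaceT; exact: cont_dot.
move: cin; rewrite inE => -[c1 cW].
exists (F c).
  by split => // E; move: c1; rewrite E dot0l => /esym/eqP; rewrite oner_eq0.
move=> f fW; rewrite c1 mulr1.
have [f0e|/dot_gt0 fpos] := pselect (f = fun=> 0).
  by rewrite f0e lin0 // !dot0l mulr0.
set z := Num.sqrt (dot f f).
have z0 : 0 < z by rewrite sqrtr_gt0.
have zz : z * z = dot f f by rewrite -expr2 sqr_sqrtr // ltW.
have := cmin (C (fun s => z^-1 * f s)); rewrite CK inE.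
move=> /(_ _)/le_trans; rewrite -zz linZ // dotZl dotZr -ler_pdivlMr ?mulr_gt0 //.
apply => //.
  split; rewrite CK; last by move=> w Ww; rewrite dotZl (fW _ Ww) mulr0.
  by rewrite dotZl dotZr -zz; field; rewrite gt_eqF.
by rewrite le_eqVlt; apply/orP; left; apply/eqP; field; rewrite gt_eqF.
Qed.

(** First-order optimality at a minimiser v of the Rayleigh quotient: A v - mu v is orthogonal to
    [orthc W], and it lies in [orthc W] by invariance, so it vanishes. Subspaces are given as
    [orthc W] so that they are closed and can be cut down by enlarging W. *)
Lemma min_eigenvector (W : (S -> R) -> Prop) A f0 :
  lin A -> selfadj A -> (forall f, orthc W f -> orthc W (A f)) ->
  orthc W f0 -> f0 <> (fun=> 0) ->
  exists mu v, [/\ orthc W v, v <> (fun=> 0), A v = (fun s => mu * v s) &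
    forall f, orthc W f -> mu * dot f f <= dot (A f) f].
Proof.
move=> lA sA stA Wf0 f00.
have [v [vW v0] vmin] := rayleigh_min lA sA Wf0 f00.
have vpos := dot_gt0 v0.
pose mu := dot (A v) v / dot v v.
have mumin f : orthc W f -> mu * dot f f <= dot (A f) f.
  move=> fW; have := vmin f fW; rewrite -ler_pdivrMr // /mu; apply: le_trans.
  by rewrite le_eqVlt; apply/orP; left; apply/eqP; field; rewrite gt_eqF.
exists mu, v; split => //.
pose z s := (- mu) * v s + A v s.
have WZ a f g : orthc W f -> orthc W g -> orthc W (fun s => a * f s + g s).
  by move=> fW gW w Ww; rewrite dotDZl fW // gW // mulr0 addr0.
have zW : orthc W z by apply: WZ => //; exact: stA.
have zw w : orthc W w -> dot z w = 0.
  move=> wW.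
  have : 2 * dot z w = 0.
    apply: (@quad_linear_coef _ (dot (A w) w - mu * dot w w)) => t.
    have := mumin (fun s => t * w s + v s) (WZ _ _ _ wW vW).
    rewrite lA !(dotDZl, dotDZr) -subr_ge0 => /le_trans; apply.
    rewrite (sA w v) (dotC w (A v)) (dotC v w) le_eqVlt; apply/orP; left; apply/eqP.
    have muE : mu * dot v v = dot (A v) v by rewrite /mu; field; rewrite gt_eqF.
    transitivity (t ^+ 2 * dot (A w) w + 2 * t * dot (A v) w + dot (A v) v
      - mu * (t ^+ 2 * dot w w) - mu * (2 * t * dot w v) - mu * dot v v).
      ring.
    rewrite muE; ring.
  by move/eqP; rewrite mulf_eq0 pnatr_eq0 /= => /eqP.
have /funeqP z0 := dot_eq0 (zw z zW).
apply/funext => s; have := z0 s; rewrite /z; lra.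
Qed.

(** The kernel of a self-adjoint operator is the orthogonal complement of its range; this puts
    eigenspaces into the form [orthc W]. *)
Lemma eigen_orthc A mu f : lin A -> selfadj A ->
  orthc (fun w => exists g, w = (fun s => (- mu) * g s + A g s)) f <->
  A f = fun s => mu * f s.
Proof.
move=> lA sA; split=> [fW|fA w [g ->]].
  have /funeqP zz : (fun s => (- mu) * f s + A f s) = fun=> 0.
    apply: dot_eq0; rewrite dotDZl sA -dotDZr.
    by apply: fW; exists (fun s => - mu * f s + A f s).
  by apply/funext => s; have := zz s; lra.
by rewrite dotDZr -sA fA dotZl; ring.
Qed.

(** Adding the range of A m - mu to W cuts the space down to an eigenspace of [A m], which the other
    operators preserve because they commute with [A m]. *)
Lemma joint_eigenvector m (A : nat -> (S -> R) -> S -> R) :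
  (forall i, (i < m)%N -> lin (A i)) -> (forall i, (i < m)%N -> selfadj (A i)) ->
  (forall i j f, (i < m)%N -> (j < m)%N -> A i (A j f) = A j (A i f)) ->
  forall (W : (S -> R) -> Prop) f0,
  (forall i, (i < m)%N -> forall f, orthc W f -> orthc W (A i f)) ->
  orthc W f0 -> f0 <> (fun=> 0) ->
  exists v (a : nat -> R), [/\ orthc W v, v <> (fun=> 0) &
    forall i, (i < m)%N -> A i v = fun s => a i * v s].
Proof.
elim: m => [|m IH] lA sA cA W f0 stW fW f00.
  by exists f0, (fun=> 0).
have mm : (m < m.+1)%N by [].
have [mu [v [vW v0 Av _]]] := min_eigenvector (lA m mm) (sA m mm) (stW m mm) fW f00.
pose W' w := W w \/ exists f, w = (fun s => (- mu) * f s + A m f s).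
have W'P f : orthc W' f <-> orthc W f /\ A m f = fun s => mu * f s.
  rewrite -(eigen_orthc mu f (lA m mm) (sA m mm)); split=> [H|[fW' fA] w].
    by split=> w Ww; apply: H; [left|right].
  by case; [exact: fW'|exact: fA].
have ltS i : (i < m)%N -> (i < m.+1)%N by move/ltnW.
have [||||||w [a [wW w0 wa]]] := IH _ _ _ W' v.
- by move=> i /ltS; exact: lA.
- by move=> i /ltS; exact: sA.
- by move=> i j f /ltS im /ltS; exact: cA.
- move=> i im f /W'P[fW' fA]; apply/W'P; split; first by apply: stW => //; exact: ltS.
  by rewrite cA //; [rewrite fA linZ //; apply: lA|]; exact: ltS.
- exact/W'P.
- exact: v0.
exists w, (fun i => if i == m then mu else a i).
move/W'P: wW => [wW wm]; split => // i; rewrite ltnS leq_eqVlt => /predU1P[->|im].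
  by rewrite eqxx.
by rewrite ltn_eqF //; exact: wa.
Qed.

End Dot.

(** * The octopus inequality *)

Section Translation.
Variables (R : realType) (V : finType).
Implicit Types (f h : {perm V} -> R) (g : {perm V}) (x y z : V).

Definition ltrans g f : {perm V} -> R := fun s => f (g * s)%g.

Lemma sum_ltrans g f : \sum_s f (g * s)%g = \sum_s f s.
Proof. by rewrite [RHS](reindex_inj (mulgI g)). Qed.

Lemma dot_ltrans g f h : dot (ltrans g f) (ltrans g h) = dot f h.
Proof. exact: (sum_ltrans g (fun s => f s * h s)). Qed.

Lemma tpermKg x y (s : {perm V}) : (tperm x y * (tperm x y * s))%g = s.
Proof. by rewrite mulgA tperm2 mul1g. Qed.

Lemma dot_ltrans_tperm x y f h :
  dot (ltrans (tperm x y) f) h = dot f (ltrans (tperm x y) h).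
Proof.
rewrite -(dot_ltrans (tperm x y)); congr dot; apply/funext => s.
by rewrite /ltrans tpermKg.
Qed.

Definition swap_energy f x y : R := \sum_s (f (tperm x y * s)%g - f s) ^+ 2.

Lemma swap_energyE f x y :
  swap_energy f x y = 2 * (dot f f - dot (ltrans (tperm x y) f) f).
Proof.
rewrite mulrBr mulr_natl mulr2n -{1}(dot_ltrans (tperm x y)) /dot mulr_sumr.
rewrite -big_split -sumrB; apply: eq_bigr => s _ /=; rewrite /ltrans; ring.
Qed.

Lemma swap_energy_ge0 f x y : 0 <= swap_energy f x y.
Proof. by apply: sumr_ge0 => s _; exact: sqr_ge0. Qed.

Lemma swap_energyC f x y : swap_energy f x y = swap_energy f y x.
Proof. by rewrite /swap_energy tpermC. Qed.

Lemma swap_energyxx f x : swap_energy f x x = 0.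
Proof. by rewrite /swap_energy big1 // => s _; rewrite tperm1 mul1g subrr expr0n. Qed.

(** The transposition of x and z is the conjugate of that of y and z by that of x and y: a product
    of three transpositions, two of which exchange x and y. Cauchy-Schwarz over the three increments
    gives 3 (2 E(x,y) + E(y,z)), whence the constant 6. *)
Lemma swap_energy_triangle f x y z :
  swap_energy f x z <= 6 * (swap_energy f x y + swap_energy f y z).
Proof.
have Exy := swap_energy_ge0 f x y; have Eyz := swap_energy_ge0 f y z.
case: (eqVneq x y) => [<-|xy].
  by rewrite swap_energyxx add0r; have := swap_energy_ge0 f x z; lra.
case: (eqVneq y z) => [<-|yz].
  by rewrite swap_energyxx addr0; lra.
case: (eqVneq x z) => [<-|xz].
  by rewrite swap_energyxx mulr_ge0 // addr_ge0 // swap_energy_ge0.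
have E : tperm x z = (tperm x y * (tperm y z * tperm x y))%g.
  have := tpermJ y z (tperm x y); rewrite tpermR tpermD // => <-.
  by rewrite conjgE tpermV.
apply: (@le_trans _ _ (3 * (swap_energy f x y + swap_energy f y z + swap_energy f x y))); last lra.
have -> : swap_energy f x y + swap_energy f y z + swap_energy f x y
  = \sum_s (f (tperm x y * s)%g - f s) ^+ 2
  + \sum_s (f (tperm y z * (tperm x y * s))%g - f (tperm x y * s)%g) ^+ 2
  + \sum_s (f (tperm x y * (tperm y z * (tperm x y * s)))%g
           - f (tperm y z * (tperm x y * s))%g) ^+ 2.
  rewrite (sum_ltrans (tperm x y) (fun s => (f (tperm y z * s)%g - f s) ^+ 2)).
  rewrite (sum_ltrans (tperm x y) (fun s => (f (tperm x y * (tperm y z * s))%g -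
     f (tperm y z * s)%g) ^+ 2)).
  by rewrite (sum_ltrans (tperm y z) (fun s => (f (tperm x y * s)%g - f s) ^+ 2)).
rewrite -!big_split mulr_sumr; apply: ler_sum => s _ /=; rewrite E -!mulgA.
set a := f s; set b := f (_ * s)%g; set c := f (_ * (_ * s))%g; set d := f _.
have := sqr_ge0 ((d - c) - (c - b)); have := sqr_ge0 ((d - c) - (b - a)).
have := sqr_ge0 ((c - b) - (b - a)); nra.
Qed.

End Translation.

(** * Jucys-Murphy elements and Young's rules for their joint spectrum *)

Section JucysMurphy.
Variables (R : realType) (V : finType) (x : nat -> V) (p : nat).
Hypothesis x_inj : forall i j, (i < p)%N -> (j < p)%N -> x i = x j -> i = j.
Implicit Types (f : {perm V} -> R) (s : {perm V}).

Definition jm k f : {perm V} -> R :=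
  fun s => \sum_(j < k) f (tperm (x j) (x k) * s)%g.

Lemma jm_lin k : lin (jm k).
Proof.
move=> a f g; apply/funext => s.
by rewrite /jm big_split /= mulr_sumr.
Qed.

Lemma jm_selfadj k : selfadj (jm k).
Proof.
move=> f g; rewrite /jm (dot_suml _ _ (fun j : 'I_k => ltrans (tperm (x j) (x k)) f)).
rewrite (dot_sumr _ _ (fun j : 'I_k => ltrans (tperm (x j) (x k)) g)).
by apply: eq_bigr => j _; exact: dot_ltrans_tperm.
Qed.

Lemma x_neq i j : (i < p)%N -> (j < p)%N -> i != j -> x i != x j.
Proof. by move=> ip jp; apply: contra => /eqP /(x_inj ip jp) ->. Qed.

(** Conjugation by a transposition of two points before [x k] only permutes the terms of [jm k]. *)
Lemma jm_ltrans_lt k b c f : (b < k)%N -> (c < k)%N -> (k < p)%N ->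
  jm k (ltrans (tperm (x b) (x c)) f) = ltrans (tperm (x b) (x c)) (jm k f).
Proof.
move=> bk ck kp; apply/funext => s; rewrite /ltrans /jm.
pose B := Ordinal bk; pose C := Ordinal ck.
rewrite [LHS](reindex_inj (@perm_inj _ (tperm B C))); apply: eq_bigr => j _ /=.
congr f; rewrite !mulgA; congr (_ * _)%g.
have -> : x (tperm B C j) = tperm (x b) (x c) (x j).
  have jp := ltn_trans (ltn_ord j) kp.
  have bp := ltn_trans bk kp; have cp := ltn_trans ck kp.
  case: (tpermP B C j) => [->|->|jb jc]; rewrite ?tpermL ?tpermR //.
  rewrite tpermD //; apply: x_neq => //; apply/eqP => E.
    by apply: jb; apply: val_inj.
  by apply: jc; apply: val_inj.
have Ek : tperm (x b) (x c) (x k) = x k.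
  by rewrite tpermD //; apply: x_neq => //; rewrite ?ltn_eqF //; apply: ltn_trans kp.
by rewrite -[in LHS]Ek -tpermJ conjgE tpermV !mulgA tperm2 mul1g.
Qed.

Lemma jm_ltrans_gt k b c f : (k < b)%N -> (k < c)%N -> (b < p)%N -> (c < p)%N ->
  jm k (ltrans (tperm (x b) (x c)) f) = ltrans (tperm (x b) (x c)) (jm k f).
Proof.
move=> kb kc bp cp; apply/funext => s; rewrite /ltrans /jm; apply: eq_bigr => j _.
congr f; rewrite !mulgA; congr (_ * _)%g.
have kp := ltn_trans kb bp.
have E i : (i <= k)%N -> tperm (x b) (x c) (x i) = x i.
  move=> ik; have ip := leq_ltn_trans ik kp.
  by rewrite tpermD // x_neq // gtn_eqF // (leq_ltn_trans ik).
rewrite -[in LHS](E j (ltnW (ltn_ord j))) -[in LHS](E k (leqnn k)).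
by rewrite -tpermJ conjgE tpermV !mulgA tperm2 mul1g.
Qed.

Lemma jm_comm i j f : (i < p)%N -> (j < p)%N -> jm i (jm j f) = jm j (jm i f).
Proof.
wlog ij : i j / (i < j)%N => [hw ip jp|].
  by case: (ltngtP i j) => [/hw->|/hw->|->].
move=> ip jp; apply/funext => s.
transitivity (\sum_(b < i) jm j (ltrans (tperm (x b) (x i)) f) s).
  apply: eq_bigr => b _; rewrite jm_ltrans_lt //.
  exact: ltn_trans ij.
by rewrite /jm exchange_big.
Qed.

(** Conjugation by g turns the transposition of [x j] and [x i] into that of [x j] and [x i.+1]; the
    one remaining term of [jm i.+1] is g itself. *)
Lemma jmS i f : (i.+1 < p)%N -> let g := tperm (x i) (x i.+1) in
  jm i.+1 f = fun s => ltrans g (jm i (ltrans g f)) s + ltrans g f s.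
Proof.
move=> ip g; apply/funext => s; rewrite /jm big_ord_recr /=; congr (_ + _).
apply: eq_bigr => j _; rewrite /ltrans; congr f; rewrite !mulgA; congr (_ * _)%g.
have jp : (j < p)%N by rewrite (ltn_trans (ltn_ord j)) // (ltn_trans _ ip).
have ip' : (i < p)%N by rewrite (ltn_trans _ ip).
have Ej : g (x j) = x j.
  by rewrite /g tpermD // x_neq // gtn_eqF // (ltn_trans (ltn_ord j)).
have Ei : g (x i) = x i.+1 by rewrite tpermL.
by rewrite -[in LHS]Ej -[in LHS]Ei -tpermJ conjgE tpermV !mulgA.
Qed.

(* The joint spectrum of the Jucys-Murphy elements; in representation-theoretic
   terms, its members are the content vectors of standard Young tableaux. *)
Definition content q (a : nat -> R) := exists2 v : {perm V} -> R, v <> (fun=> 0) &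
  forall k, (k < q)%N -> jm k v = fun s => a k * v s.

Lemma content_le q q' a : (q' <= q)%N -> content q a -> content q' a.
Proof. by move=> qq [v v0 va]; exists v => // k /leq_trans/(_ qq)/va. Qed.

Definition exch (a : nat -> R) i := fun k =>
  if k == i then a i.+1 else if k == i.+1 then a i else a k.

(** Young's exchange rule. With u the translate of v by the transposition of [x i] and [x i.+1], and
    d the difference of the two contents, the intertwining vector d u - v has these contents
    exchanged. If it vanishes then v = d u, and d^2 = 1 because translation is an isometry. *)
Lemma content_swap q a i : (q <= p)%N -> (i.+1 < q)%N -> content q a ->
  (a i.+1 - a i) ^+ 2 = 1 \/ content q (exch a i).
Proof.
move=> qp iq [v v0 va]; pose g := tperm (x i) (x i.+1); pose u := ltrans g v.
pose d := a i.+1 - a i.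
have ip := leq_trans iq qp; have iq' := ltnW iq.
have gu : ltrans g u = v by apply/funext => s; rewrite /u /ltrans /g tpermKg.
have Ji1u : jm i.+1 u = fun s => a i * u s + v s.
  by rewrite jmS // -/g gu va //; apply/funext => s.
have Jiu : jm i u = fun s => a i.+1 * u s - v s.
  have us s : u (g * s)%g = v s by rewrite /u /ltrans tpermKg.
  have E s : a i.+1 * u s = jm i u s + v s.
    transitivity (jm i.+1 v (g * s)%g); first by rewrite va.
    by rewrite jmS // -/g -/u us {1}/ltrans /g tpermKg.
  by apply/funext => s; rewrite E addrK.
pose w s := d * u s + (-1) * v s.
have [w0|w0] := pselect (w = fun=> 0).
  left; have uv s : v s = d * u s by have /funeqP/(_ s) := w0; rewrite /w; lra.
  have vv : dot v v = d ^+ 2 * dot v v.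
    transitivity (dot (fun s => d * u s) (fun s => d * u s)).
      by congr dot; apply/funext.
    by rewrite dotZl dotZr dot_ltrans; ring.
  have := dot_gt0 v0 => vpos; apply: (@mulIf _ (dot v v)); rewrite ?gt_eqF // mul1r.
  by rewrite -vv.
right; exists w => // k kq; have kp := leq_trans kq qp.
have wlin : jm k w = fun s => d * jm k u s + (-1) * jm k v s.
  by rewrite /w (jm_lin k d u (fun s => -1 * v s)) linZ //; exact: jm_lin.
rewrite wlin va //; apply/funext => s; rewrite /exch.
have [ki|ki] := eqVneq k i; first by rewrite ki Jiu /w /d; ring.
have [ki1|ki1] := eqVneq k i.+1; first by rewrite ki1 Ji1u /w /d; ring.
have -> : jm k u = fun s => a k * u s.
  rewrite /u; case: (ltngtP k i) ki => // [lt _|gt _].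
    by rewrite jm_ltrans_gt ?va //; lia.
  by rewrite jm_ltrans_lt ?va //; lia.
by rewrite /w; ring.
Qed.

Lemma sqr_eq1_bounds (z : R) : z ^+ 2 = 1 -> - 1 <= z <= 1.
Proof. by move=> z1; rewrite -ler_norml -(@expr_le1 _ 2) // real_normK ?num_real // z1. Qed.

(** In the induction step let b, c, d be the last three contents. Unless |d - c| = 1, c and d can be
    exchanged, and the hypothesis bounds d - b by q + 1, which suffices if |c - b| = 1. Otherwise b
    and c can be exchanged as well: then either |d - b| = 1 and the hypothesis bounds c's gap b - c,
    or c, d, b is also allowed and the hypothesis bounds d - c. *)
Lemma content_gap q a : (q.+2 <= p)%N -> content q.+2 a -> a q.+1 - a q <= q.+1%:R.
Proof.
elim: q a => [|q IH] a qp ca.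
  have [v v0 va] := ca; have a0 : a 0 = 0.
    have := va 0%N isT; rewrite (_ : jm 0 v = fun=> 0); last first.
      by apply/funext => s; rewrite /jm big_ord0.
    move=> /funeqP E; have [s vs] : exists s, v s <> 0.
      by apply/existsNP => H; apply: v0; apply/funext.
    by have /esym/eqP := E s; rewrite mulf_eq0 => /orP[/eqP|/eqP].
  have [E|cs] := content_swap qp (isT : 1 < 2)%N ca.
    by have /andP[_] := sqr_eq1_bounds E.
  have [w w0 wa] := cs; have : a 1 = 0; last by lra.
  have := wa 0%N isT; rewrite (_ : jm 0 w = fun=> 0); last first.
    by apply/funext => s; rewrite /jm big_ord0.
  move=> /funeqP E; have [s vs] : exists s, w s <> 0.
    by apply/existsNP => H; apply: w0; apply/funext.
  by have /esym/eqP := E s; rewrite mulf_eq0 => /orP[/eqP|/eqP].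
have qp' := ltnW qp.
have {}IH b : content q.+3 b -> b q.+1 - b q <= q.+1%:R.
  by move=> cb; apply: IH => //; apply: content_le cb.
have q1 : q.+2%:R = q.+1%:R + 1 :> R by rewrite -natr1.
have H1 : (q.+1 < q.+3)%N by [].
have H2 : (q.+2 < q.+3)%N by [].
have e0 : (q == q.+2) = false by lia.
have e1 : (q == q.+1) = false by lia.
have e2 : (q.+1 == q) = false by lia.
have e3 : (q.+2 == q) = false by lia.
have e4 : (q.+2 == q.+1) = false by lia.
have e5 : (q.+1 == q.+2) = false by lia.
have [E1|c1] := content_swap qp H1 ca; have [E2|c2] := content_swap qp H2 ca.
- have /andP[_ d1] := sqr_eq1_bounds E2; have := ler0n R q.+1; lra.
- have /andP[d0 _] := sqr_eq1_bounds E1.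
  have := IH _ c2; rewrite /exch !(eqxx, e0, e1, e2, e3, e4, e5); lra.
- have /andP[_ d1] := sqr_eq1_bounds E2; have := ler0n R q.+1; lra.
- have [E3|c3] := content_swap qp H2 c1.
    have /andP[_] := sqr_eq1_bounds E3; have := IH _ c1.
    by rewrite /exch !(eqxx, e0, e1, e2, e3, e4, e5); lra.
  have := IH _ c3.
  by rewrite /exch !(eqxx, e0, e1, e2, e3, e4, e5); lra.
Qed.

(** This is the octopus inequality on a joint eigenvector, with equality for a_i = i, the contents
    of a constant function. If the last two contents can be exchanged, induction applies to the
    exchanged vector and [content_gap] bounds the new term; otherwise they differ by 1 and induction
    applies to [a] itself. *)
Lemma content_star q a : (q < p)%N -> content q.+1 a ->
  \sum_(i < q) (a q - a i) <= q%:R * q.+1%:R / 2.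
Proof.
elim: q a => [|q IH] a qp ca; first by rewrite big_ord0 mul0r mul0r.
have gap := content_gap qp ca.
rewrite big_ord_recr /=.
have [E|cs] := content_swap qp (ltnSn q.+1) ca.
  have := IH a (ltnW qp) (content_le (leqnSn _) ca).
  have -> : \sum_(i < q) (a q.+1 - a i) = q%:R * (a q.+1 - a q) + \sum_(i < q) (a q - a i).
    rewrite -[q in q%:R]card_ord mulr_natl -sumr_const -big_split.
    by apply: eq_bigr => i _ /=; ring.
  have /andP[_ d1] := sqr_eq1_bounds E.
  have : q%:R * (a q.+1 - a q) <= q%:R :> R by rewrite ler_piMr.
  rewrite -!(natr1 q.+1) -!(natr1 q); nra.
have := IH _ (ltnW qp) (content_le (leqnSn _) cs).
rewrite (eq_bigr (fun i : 'I_q => a q.+1 - a i)); last first.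
  move=> i _; rewrite /exch eqxx !ltn_eqF //; exact: ltn_trans (ltn_ord i) _.
move: gap; rewrite -!(natr1 q.+1) -!(natr1 q); nra.
Qed.

(** The difference of the two sides is the quadratic form of A below. The operators [jm k] commute
    with A, so its lowest eigenspace contains a joint eigenvector of them; there the eigenvalue is c
    minus the sum bounded in [content_star]. *)
Lemma jm_star q f : (q < p)%N ->
  \sum_(i < q.+1) (i%:R * dot f f - dot (jm i f) f)
    <= q.+1%:R * (q%:R * dot f f - dot (jm q f) f).
Proof.
move=> qp; pose c : R := q%:R * q.+1%:R / 2.
have sumid n : \sum_(i < n.+1) (i%:R : R) = n%:R * n.+1%:R / 2.
  elim: n => [|n IH]; first by rewrite big_ord_recr big_ord0 /= !mul0r addr0.
  by rewrite big_ord_recr /= IH -!(natr1 n.+1) -!(natr1 n); field.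
pose B f s := (- q.+1%:R) * jm q f s + \sum_(i < q.+1) jm i f s.
pose A f s := c * f s + B f s.
have lB : lin B.
  move=> a g h; apply/funext => s; rewrite /B jm_lin.
  under eq_bigr do rewrite jm_lin.
  by rewrite big_split /= -mulr_sumr; ring.
have lA : lin A by move=> a g h; rewrite /A lB; apply/funext => s; ring.
have sA : selfadj A.
  move=> g h; rewrite /A /B !(dotDZl, dotDZr) jm_selfadj; congr (_ + (_ + _)).
  by rewrite dot_suml dot_sumr; apply: eq_bigr => i _; rewrite jm_selfadj.
have cA k g : (k < p)%N -> A (jm k g) = jm k (A g).
  move=> kp; rewrite /A (jm_lin k c g (B g)); suff -> : B (jm k g) = jm k (B g) by [].
  apply/funext => s; rewrite /B jm_lin jm_comm //; congr (_ + _).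
  have -> : (fun s => \sum_(i < q.+1) jm i g s) = fun s => \sum_(i < q.+1) 1 * jm i g s.
    by apply/funext => s'; apply: eq_bigr => i _; rewrite mul1r.
  rewrite (lin_sum _ _ _ _ (@jm_lin k)); apply: eq_bigr => i _.
  by rewrite mul1r jm_comm // (leq_trans (ltn_ord i)).
suff : 0 <= dot (A f) f.
  rewrite /A dotDZl /B dotDZl (dot_suml _ _ (fun i : 'I_q.+1 => jm i f)).
  rewrite sumrB -mulr_suml sumid /c -(natr1 q).
  move: (dot f f) (dot (jm q f) f) (\sum_(i < q.+1) dot (jm i f) f) => a b z; nra.
have [->|f0] := pselect (f = fun=> 0); first by rewrite (lin0 lA) dot0l.
have [mu [v [_ v0 Av /(_ f) min]]] := @min_eigenvector _ _ (fun=> False) A f lA sA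
  (fun _ _ _ => ltac:(done)) (fun _ => ltac:(done)) f0.
suff : 0 <= mu.
  by move=> mu0; apply: le_trans (min (fun _ => False_ind _)); rewrite mulr_ge0 // dot_ge0.
pose W w := exists g, w = fun s => (- mu) * g s + A g s.
have kp k : (k < q.+1)%N -> (k < p)%N by move/leq_trans; apply.
have [||||||w [a [/(eigen_orthc _ _ lA sA) wW w0 wa]]] := @joint_eigenvector _ _ q.+1 jm _ _ _ W v.
- by move=> i _; exact: jm_lin.
- by move=> i _; exact: jm_selfadj.
- by move=> i j g /kp ip /kp jp; exact: jm_comm.
- move=> i /kp ip g /(eigen_orthc _ _ lA sA) gW; apply/(eigen_orthc _ _ lA sA).
  by rewrite cA // gW linZ //; exact: jm_lin.
- exact/(eigen_orthc _ _ lA sA).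
- exact: v0.
have /(content_star qp) ca : content q.+1 a by exists w.
have [s ws] : exists s, w s <> 0.
  by apply/existsNP => H; apply: w0; apply/funext.
have /funeqP/(_ s) := wW; rewrite /A /B wa //.
rewrite (eq_bigr (fun i : 'I_q.+1 => a i * w s)); last by move=> i _; rewrite wa.
rewrite -mulr_suml => E.
have muE : mu = c + \sum_(i < q.+1) a i - q.+1%:R * a q.
  apply: (@mulIf _ (w s)); first exact/eqP.
  by rewrite -E; ring.
move: ca; rewrite muE big_ord_recr /= sumrB sumr_const card_ord -[a q *+ q]mulr_natl.
rewrite /c -(natr1 q); lra.
Qed.

End JucysMurphy.

Lemma sum_sym_pairs (R : realType) (e : nat -> nat -> R) q :
  (forall i j, e i j = e j i) -> (forall i, e i i = 0) ->
  \sum_(i < q) \sum_(j < q) e i j = 2 * \sum_(i < q) \sum_(j < i) e j i.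
Proof.
move=> eC e0; elim: q => [|q IH]; first by rewrite !big_ord0 mulr0.
rewrite !big_ord_recr /= e0 addr0.
under eq_bigr do rewrite big_ord_recr /=.
rewrite big_split /= IH (eq_bigr (fun i : 'I_q => e i q) (fun i _ => eC q i)).
ring.
Qed.

Lemma octopus (R : realType) (V : finType) (f : {perm V} -> R) (c : V) (A : {set V}) :
  c \notin A ->
  \sum_(y in A) \sum_(z in A) swap_energy f y z
    <= 2 * #|A|%:R * \sum_(y in A) swap_energy f c y.
Proof.
(* The default value of [nth] makes c the point of index q, after those of A: the star centred at c
   becomes the last Jucys-Murphy element. *)
move=> cA; pose x := nth c (enum A); pose q := #|A|.
have szA : size (enum A) = q by rewrite -cardE.
have xq : x q = c by rewrite /x nth_default // szA.
have xA i : (i < q)%N -> x i \in A by move=> iq; rewrite -mem_enum mem_nth // szA.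
have sumA (F : V -> R) : \sum_(y in A) F y = \sum_(i < q) F (x i).
  by rewrite -big_enum /= (big_nth c) szA big_mkord.
have x_inj i j : (i < q.+1)%N -> (j < q.+1)%N -> x i = x j -> i = j.
  rewrite !ltnS [(i <= q)%N]leq_eqVlt [(j <= q)%N]leq_eqVlt.
  move=> /predU1P[->|iq] /predU1P[->|jq] //.
  - by rewrite xq => E; have := xA j jq; rewrite -E (negbTE cA).
  - by rewrite xq => E; have := xA i iq; rewrite E (negbTE cA).
  - by move=> /eqP; rewrite nth_uniq ?szA ?enum_uniq // => /eqP.
have jmE i : \sum_(j < i) swap_energy f (x j) (x i)
    = 2 * (i%:R * dot f f - dot (jm x i f) f).
  under eq_bigr do rewrite swap_energyE.
  rewrite -mulr_sumr sumrB sumr_const card_ord -[dot f f *+ i]mulr_natl.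
  by rewrite -(dot_suml _ _ (fun j : 'I_i => ltrans (tperm (x j) (x i)) f)).
rewrite [leLHS]sumA [X in _ * X]sumA; under eq_bigr do rewrite sumA.
have -> := @sum_sym_pairs _ (fun i j => swap_energy f (x i) (x j)) q
  (fun i j => swap_energyC _ _ _) (fun i => swap_energyxx _ _).
have := jm_star x_inj f (ltnSn q); rewrite big_ord_recr /= => H.
have -> : \sum_(i < q) swap_energy f c (x i) = \sum_(i < q) swap_energy f (x i) (x q).
  by apply: eq_bigr => i _; rewrite xq swap_energyC.
rewrite jmE; under eq_bigr do rewrite jmE.
move: H; rewrite -mulr_sumr -(natr1 q); nra.
Qed.

(** * Comparison of the product with the complete graph *)

Lemma perm_imset_card (T : finType) (A B : {set T}) :
  #|A| = #|B| -> exists s : {perm T}, s @: A = B.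
Proof.
move=> AB.
have [A0|[x0 x0A]] := set_0Vmem A.
  by exists 1%g; rewrite A0 imset0; apply/esym/eqP; rewrite -cards_eq0 -AB A0 cards0.
pose la := enum A ++ enum (~: A); pose lb := enum B ++ enum (~: B).
have uni (C : {set T}) : uniq (enum C ++ enum (~: C)).
  rewrite cat_uniq !enum_uniq andbT /=; apply/hasPn => x.
  by rewrite !mem_enum inE.
have mem_all (C : {set T}) x : x \in enum C ++ enum (~: C).
  by rewrite mem_cat !mem_enum inE orbN.
have sz (C : {set T}) : size (enum C ++ enum (~: C)) = #|T|.
  by rewrite size_cat -!cardE cardsC.
pose f x := nth x0 lb (index x la).
have f_inj : injective f.
  move=> x y /eqP; rewrite nth_uniq ?uni // ?(sz B) -?(sz A) ?index_mem ?mem_all //.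
  by move/eqP/(congr1 (nth x0 la)); rewrite !nth_index ?mem_all.
exists (perm f_inj); apply/eqP; rewrite eqEcard card_imset ?AB ?leqnn ?andbT; last exact: perm_inj.
apply/fintype.subsetP => _ /imsetP[x xA ->]; rewrite permE /f.
have ix : (index x la < #|B|)%N.
  by rewrite index_cat mem_enum xA -AB cardE index_mem mem_enum.
by rewrite nth_cat -cardE ix -mem_enum mem_nth // -cardE.
Qed.

(** * Resampling energies of sets of coordinates *)

Section Splice.
Variables (R : realType) (n : nat) (X : finType).
Local Notation V := {ffun 'I_n -> X}.
Implicit Types (S T : {set 'I_n}) (x u v w : V).

Definition splice S x u : V := [ffun i => if i \in S then u i else x i].

Lemma sum_splice S (phi : V -> V -> R) :
  \sum_x \sum_u phi (splice S x u) (splice S u x) = \sum_x \sum_u phi x u.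
Proof.
pose h (q : V * V) := (splice S q.1 q.2, splice S q.2 q.1).
have hK : involutive h.
  move=> [x u]; rewrite /h /=; congr (_, _); apply/ffunP => i; rewrite !ffunE;
    by case: (i \in S).
rewrite !pair_big /= [RHS](reindex_inj (inv_inj hK)).
by apply: eq_bigr => -[x u] _.
Qed.

Lemma sum_splice1 S (psi : V -> R) :
  \sum_x \sum_u psi (splice S x u) = #|{: V}|%:R * \sum_x psi x.
Proof.
rewrite (sum_splice S (fun x _ => psi x)) exchange_big /= sumr_const mulr_natl.
by rewrite cardT.
Qed.

Variable E : V -> V -> R.

Definition resample S : R := \sum_x \sum_u E x (splice S x u).

Lemma spliceK S x u : splice S (splice S x u) (splice S u x) = x.
Proof. by apply/ffunP => i; rewrite !ffunE; case: (i \in S). Qed.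

Lemma splice_union S T x u w :
  splice T (splice S x u) w = splice (S :|: T) x (splice T u w).
Proof.
by apply/ffunP => i; rewrite !ffunE inE; case: (i \in S); case: (i \in T).
Qed.

(** Reversibility of resampling: a uniform pair (x, u) stays uniform when its S-coordinates are
    exchanged. Seen from the first endpoint, x is itself a resampling in S, and the second endpoint
    then resamples T too. *)
Lemma resample_union S T :
  \sum_x \sum_u \sum_w E (splice S x u) (splice T x w)
    = #|{: V}|%:R * resample (S :|: T).
Proof.
pose Phi x u := \sum_w E x (splice T (splice S x u) w).
transitivity (\sum_x \sum_u Phi (splice S x u) (splice S u x)).
  by apply: eq_bigr => x _; apply: eq_bigr => u _; rewrite /Phi spliceK.
rewrite sum_splice mulr_sumr; apply: eq_bigr => x _.
transitivity (\sum_u \sum_w E x (splice (S :|: T) x (splice T u w))).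
  by apply: eq_bigr => u _; apply: eq_bigr => w _; rewrite splice_union.
exact: (sum_splice1 T (fun u => E x (splice (S :|: T) x u))).
Qed.

Hypothesis E_ge0 : forall x y, 0 <= E x y.
Hypothesis Exx : forall x, E x x = 0.
Hypothesis EC : forall x y, E x y = E y x.
Hypothesis E_triangle : forall x y z, E x z <= 6 * (E x y + E y z).
Hypothesis E_octopus : forall c (A : {set V}), c \notin A ->
  \sum_(y in A) \sum_(z in A) E y z <= 2 * #|A|%:R * \sum_(y in A) E c y.
Hypothesis X_gt0 : (0 < #|X|)%N.

Let N_gt0 : 0 < #|{: V}|%:R :> R.
Proof. by rewrite ltr0n card_ffun expn_gt0 X_gt0. Qed.

Lemma resample_ge0 S : 0 <= resample S.
Proof. by apply: sumr_ge0 => x _; apply: sumr_ge0. Qed.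

Lemma resample_union_triangle S T :
  resample (S :|: T) <= 6 * (resample S + resample T).
Proof.
rewrite -(ler_pM2l N_gt0) -resample_union.
apply: (@le_trans _ _ (\sum_x \sum_u \sum_w 6 * (E x (splice S x u) + E x (splice T x w)))).
  apply: ler_sum => x _; apply: ler_sum => u _; apply: ler_sum => w _.
  by apply: le_trans (E_triangle _ x _) _; rewrite EC.
have -> : #|{: V}|%:R * (6 * (resample S + resample T)) = \sum_x
    6 * (#|{: V}|%:R * \sum_u E x (splice S x u) + #|{: V}|%:R * \sum_w E x (splice T x w)).
  by rewrite -mulr_sumr big_split /= -!mulr_sumr /resample; ring.
have cst (z : R) : \sum_(u : V) z = #|{: V}|%:R * z by rewrite sumr_const mulr_natl cardT.
apply: ler_sum => x _; under eq_bigr do rewrite -mulr_sumr big_split /= cst.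
by rewrite -mulr_sumr big_split /= cst -mulr_sumr.
Qed.

(** Since the octopus inequality is available for equal weights, the values other than c must all
    repeat equally often. Indices sent to c have energy zero on the right, but their share of [#|I|]
    pays exactly for the terms between c and the other values on the left. *)
Lemma octopus_multi (I : finType) (y : I -> V) (c : V) (q : nat) :
  (forall v, v != c -> #|[pred i | y i == v]| = 0%N \/ #|[pred i | y i == v]| = q) ->
  \sum_i \sum_j E (y i) (y j) <= 2 * #|I|%:R * \sum_i E c (y i).
Proof.
move=> mult; pose m v := #|[pred i | y i == v]|.
pose A := [set v | (v != c) && (m v != 0%N)].
have sumE (phi : V -> R) :
    \sum_i phi (y i) = (m c)%:R * phi c + q%:R * \sum_(v in A) phi v.
  rewrite (partition_big y xpredT) //= (bigD1 c) //=; congr (_ + _).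
    rewrite (eq_bigr (fun=> phi c)) => [|i /eqP -> //].
    by rewrite sumr_const mulr_natl.
  rewrite mulr_sumr (bigID (mem A)) /= [X in _ + X]big1 ?addr0 => [|v].
    apply: eq_big => [v|v /andP[_]]; first by rewrite !inE andbA andbb.
    rewrite inE => /andP[vc mv].
    rewrite (eq_bigr (fun=> phi v)) => [|i /eqP -> //].
    rewrite sumr_const mulr_natl; congr (_ *+ _).
    by case: (mult v vc) => // m0; move: mv; rewrite /m m0.
  rewrite inE => /andP[vc]; rewrite vc /= negbK => /eqP m0.
  rewrite big_pred0 // => i; apply/negbTE; move: m0 => /card0_eq/(_ i).
  by rewrite inE => ->.
have cardI : #|I|%:R = (m c)%:R + q%:R * #|A|%:R :> R.
  have := sumE (fun=> 1); rewrite !sumr_const mulr1 => <-.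
  by rewrite cardT.
have cA : c \notin A by rewrite inE eqxx.
have H := E_octopus cA; set z := \sum_(v in A) E c v in H.
have Hz : \sum_i E c (y i) = q%:R * z by rewrite sumE Exx mulr0 add0r.
under eq_bigr => i _ do rewrite (sumE (E (y i))).
rewrite (sumE (fun v => (m c)%:R * E v c + q%:R * \sum_(w in A) E v w)) Exx Hz cardI.
rewrite big_split /= -!mulr_sumr -/z.
have -> : \sum_(v in A) E v c = z by apply: eq_bigr => v _; rewrite EC.
have mc := ler0n R (m c); have q0 := ler0n R q.
have := ler_wpM2l q0 (ler_wpM2l q0 H); set G := \sum_(i in A) _; nra.
Qed.

Lemma card_splice_fiber S x v : (forall i, i \notin S -> v i = x i) ->
  #|[pred u | splice S x u == v]| = (#|X| ^ #|~: S|)%N.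
Proof.
move=> vx; rewrite (eq_card (B := family (fun i => if i \in S then pred1 (v i) else predT))).
  rewrite card_family foldrE big_map big_enum /= (bigID (mem S)) /=.
  rewrite big1 => [|i ->]; last exact: card1.
  rewrite mul1n (eq_bigr (fun=> #|X|)) => [|i /negbTE ->]; last by apply: eq_card.
  rewrite prod_nat_const; congr (_ ^ _)%N.
  by apply: eq_card => i; rewrite !inE.
move=> u; rewrite inE; apply/eqP/familyP => [<- i|H].
  by rewrite ffunE; case: ifP => //= ->; rewrite inE.
apply/ffunP => i; rewrite ffunE; have := H i.
case: ifP => [iS|/negbT /vx //]; by rewrite inE => /eqP.
Qed.

(** The star is centred at x, with a leaf for each block and each resampling u. As the blocks are
    disjoint, a leaf other than x determines its block, so it occurs |X|^(n - k) times, the same for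
    all blocks. Pairs of leaves from one block are discarded. *)
Lemma octopus_blocks m k (B : 'I_m -> {set 'I_n}) :
  (forall i, #|B i| = k) -> (forall i j, i != j -> [disjoint B i & B j]) ->
  \sum_i \sum_(j | j != i) resample (B i :|: B j)
    <= 2 * m%:R * \sum_i resample (B i).
Proof.
move=> Bk Bd; rewrite -(ler_pM2l N_gt0).
have step x : \sum_(p : 'I_m * V) \sum_(p' : 'I_m * V)
      E (splice (B p.1) x p.2) (splice (B p'.1) x p'.2)
    <= 2 * (m%:R * #|{: V}|%:R) * \sum_(p : 'I_m * V) E x (splice (B p.1) x p.2).
  have := @octopus_multi _ (fun p : 'I_m * V => splice (B p.1) x p.2) x (#|X| ^ (n - k)).
  rewrite card_prod card_ord natrM; apply => v vx.
  have [i0 /existsP[u0 /eqP E0]|none] := pickP (fun i => [exists u, splice (B i) x u == v]).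
    right; have agree i : i \notin B i0 -> v i = x i.
      by move=> iB; rewrite -E0 ffunE (negbTE iB).
    have := card_splice_fiber agree; rewrite cardsCs finset.setCK card_ord Bk => <-.
    have inj : injective (fun u : V => (i0, u)) by move=> u u' [].
    rewrite -(fintype.card_image inj); apply: eq_card => -[i u]; rewrite !inE /=.
    apply/idP/fintype.imageP => [/eqP E1|[u' u'v [-> ->]]]; last by rewrite inE in u'v.
    have [ii0|ii0] := eqVneq i i0; first by exists u; rewrite ?ii0 // inE -ii0 E1.
    case/eqP: vx; apply/ffunP => j.
    have [jB|jB] := boolP (j \in B i0); last by rewrite -E0 ffunE (negbTE jB).
    by rewrite -E1 ffunE (disjointFl (Bd _ _ ii0) jB).
  left; apply: eq_card0 => -[i u]; rewrite !inE /=; apply/negP => E0.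
  by have /existsP[] := negbT (none i); exists u.
have sumB (x : V) : \sum_(p : 'I_m * V) E x (splice (B p.1) x p.2)
    = \sum_i \sum_u E x (splice (B i) x u) by rewrite pair_big.
have sumBB (x : V) : \sum_(p : 'I_m * V) \sum_(p' : 'I_m * V)
      E (splice (B p.1) x p.2) (splice (B p'.1) x p'.2)
    = \sum_i \sum_j \sum_u \sum_w E (splice (B i) x u) (splice (B j) x w).
  rewrite -(pair_big xpredT xpredT (fun i u => \sum_(p' : 'I_m * V)
     E (splice (B i) x u) (splice (B p'.1) x p'.2))) /=.
  apply: eq_bigr => i _; rewrite exchange_big /=.
  rewrite -(pair_big xpredT xpredT (fun j w => \sum_u
     E (splice (B i) x u) (splice (B j) x w))) /=.
  by apply: eq_bigr => j _; rewrite exchange_big.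
have total : \sum_x \sum_i \sum_j \sum_u \sum_w E (splice (B i) x u) (splice (B j) x w)
    <= 2 * (m%:R * #|{: V}|%:R) * \sum_i resample (B i).
  rewrite /resample [X in _ * X]exchange_big /= mulr_sumr.
  by apply: ler_sum => x _; have := step x; rewrite sumBB sumB.
rewrite -[leRHS](_ : 2 * (m%:R * #|{: V}|%:R) * \sum_i resample (B i) = _); last by ring.
apply: le_trans total; rewrite [leRHS]exchange_big mulr_sumr /=.
apply: ler_sum => i _; rewrite [leRHS]exchange_big mulr_sumr /=.
rewrite [leRHS](bigID (fun j => j != i)) /= -[leLHS]addr0 lerD //.
  by apply: ler_sum => j _; rewrite resample_union.
apply: sumr_ge0 => j _; apply: sumr_ge0 => x _; apply: sumr_ge0 => u _.
exact: sumr_ge0.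
Qed.

(** The factors may be different graphs; symmetrising over the coordinates leaves a quantity that
    depends only on the size of A. *)
Definition perm_avg (A : {set 'I_n}) : R := \sum_(s : 'S_n) resample (s @: A).

Lemma perm_avg_card (A B : {set 'I_n}) : #|A| = #|B| -> perm_avg A = perm_avg B.
Proof.
move=> /perm_imset_card[g <-]; rewrite /perm_avg (reindex_inj (mulgI g)) /=.
apply: eq_bigr => s _; congr resample; rewrite -imset_comp; apply: eq_imset => i /=.
by rewrite permM.
Qed.

Definition below (k : nat) : {set 'I_n} := [set i : 'I_n | (i < k)%N].

Lemma card_interval a k : (a + k <= n)%N -> #|[set i : 'I_n | (a <= i < a + k)%N]| = k.
Proof.
move=> akn; transitivity (\sum_(a <= i < a + k) 1)%N; last first.
  by rewrite sum_nat_const_nat addKn muln1.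
rewrite -sum1_card (big_nat_widen _ _ n) // (big_nat_widenl _ 0) // big_mkord.
by apply: eq_bigl => i; rewrite inE /= andbC.
Qed.

Lemma perm_avg_double k : (0 < k)%N -> (2 * k <= n)%N ->
  (n %/ k).-1%:R * perm_avg (below (2 * k)) <= 2 * (n %/ k)%:R * perm_avg (below k).
Proof.
move=> k0 k2n; set m := (n %/ k)%N.
have mk : (m * k <= n)%N by exact: leq_trunc_div.
pose B (i : 'I_m) := [set j : 'I_n | (i * k <= j < i * k + k)%N].
have Bk i : #|B i| = k.
  by apply: card_interval; have := ltn_ord i; nia.
have Bd i j : i != j -> [disjoint B i & B j].
  move=> ij; rewrite -finset.setI_eq0; apply/eqP/finset.setP => z; rewrite !inE.
  by apply/negP; have : i <> j :> nat by [move/val_inj; apply/eqP]; nia.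
have m1 : (0 < m)%N by rewrite divn_gt0 //; lia.
have H (s : 'S_n) : \sum_i \sum_(j | j != i) resample (s @: (B i :|: B j))
    <= 2 * m%:R * \sum_i resample (s @: B i).
  under eq_bigr do under eq_bigr do rewrite imsetU.
  apply: (@octopus_blocks _ k) => [i|i j ij].
    by rewrite card_imset ?Bk //; exact: perm_inj.
  have := Bd _ _ ij; rewrite -!finset.setI_eq0 => /eqP Bij.
  by rewrite -imsetI ?Bij ?imset0 // => a b _ _; exact: perm_inj.
have : \sum_(s : 'S_n) \sum_i \sum_(j | j != i) resample (s @: (B i :|: B j))
    <= \sum_(s : 'S_n) 2 * m%:R * \sum_i resample (s @: B i) by apply: ler_sum.
rewrite -mulr_sumr exchange_big [X in _ <= _ * X]exchange_big /=.
rewrite (eq_bigr (fun=> m.-1%:R * perm_avg (below (2 * k)))) => [|i _]; last first.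
  rewrite exchange_big /= (eq_bigr (fun=> perm_avg (below (2 * k)))) => [|j ji]; last first.
    apply: perm_avg_card; rewrite cardsU; have := Bd _ _ ji.
    rewrite -finset.setI_eq0 finset.setIC => /eqP ->; rewrite cards0 !Bk.
    by have := @card_interval 0 (2 * k); rewrite add0n /= => -> //; lia.
  rewrite sumr_const mulr_natl; congr (_ *+ _).
  by rewrite (cardC1 i) card_ord.
rewrite [X in _ <= _ * X](eq_bigr (fun=> perm_avg (below k))) => [|i _]; last first.
  apply: perm_avg_card; rewrite Bk.
  by have := @card_interval 0 k; rewrite add0n /= => -> //; lia.
rewrite !sumr_const card_ord -[leLHS]mulr_natl -[X in _ <= _ * X]mulr_natl => le.
by rewrite -(@ler_pM2l _ m%:R) ?ltr0n // [leRHS]mulrCA.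
Qed.

Lemma perm_avg_ge0 (A : {set 'I_n}) : 0 <= perm_avg A.
Proof. by apply: sumr_ge0 => s _; exact: resample_ge0. Qed.

(** The exponential absorbs the product of the ratios m / (m - 1): passing from k to 2k doubles its
    exponent, which leaves room for one more factor exp(3k/n). *)
Lemma perm_avg_pow2 a : (0 < n)%N -> (2 ^ a <= n)%N ->
  perm_avg (below (2 ^ a)) <=
    (2 ^ a)%:R * expR (3 * (2 ^ a)%:R / n%:R) * perm_avg (below 1).
Proof.
move=> n0; elim: a => [|a IH] an.
  rewrite expn0 mul1r ler_peMl ?perm_avg_ge0 // -expR0 ler_expR.
  by rewrite mulr_ge0 ?invr_ge0.
set k := (2 ^ a)%N in IH *.
have kn : (2 * k <= n)%N by rewrite -expnS.
have k0 : (0 < k)%N by rewrite expn_gt0.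
have := perm_avg_double k0 kn; rewrite -expnS.
set m := (n %/ k)%N; have m2 : (2 <= m)%N by rewrite leq_divRL.
have nm : (n < (m.-1 + 2) * k)%N by have := ltn_ceil n k0; rewrite -/m; nia.
move: m2 nm; case: m => // m; rewrite ltnS /= => m1 nm H.
have {}IH : perm_avg (below k) <= k%:R * expR (3 * k%:R / n%:R) * perm_avg (below 1).
  by apply: IH; lia.
have m0 : 0 < m%:R :> R by rewrite ltr0n.
have nR : 0 < n%:R :> R by rewrite ltr0n.
(* Here m is one less than the number of blocks, and n < (m + 2) k <= 3 m k, so 1/m <= 3k/n. *)
have ratio : m.+1%:R / m%:R <= expR (3 * k%:R / n%:R) :> R.
  apply: le_trans (expR_ge1Dx _).
  rewrite -natr1 mulrDl divff ?gt_eqF // lerD2l mul1r ler_pdivlMr //.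
  rewrite mulrC ler_pdivrMr // -!natrM ler_nat; nia.
have {}H : perm_avg (below (2 ^ a.+1)) <= 2 * (m.+1%:R / m%:R) * perm_avg (below k).
  by rewrite -(ler_pM2l m0) (le_trans H) // le_eqVlt; apply/orP; left; apply/eqP; field; rewrite gt_eqF.
apply: (le_trans H).
have -> : 3 * (2 ^ a.+1)%:R / n%:R = 3 * k%:R / n%:R + 3 * k%:R / n%:R :> R.
  by rewrite expnS natrM -/k; ring.
rewrite expRD expnS natrM -/k.
set e := expR _ in ratio IH *; have e0 : 0 <= e by exact: expR_ge0.
apply: (@le_trans _ _ (2 * e * (k%:R * e * perm_avg (below 1)))); last first.
  by rewrite le_eqVlt; apply/orP; left; apply/eqP; ring.
apply: ler_pM; rewrite ?perm_avg_ge0 ?mulr_ge0 ?invr_ge0 // ler_pM2l //.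
Qed.

(** Two sets of size k, the largest power of 2 up to n, cover all coordinates, possibly with an
    overlap. The crude triangle inequality is used this once and gives the factor 12; all the
    doublings together cost exp(3k/n) <= exp 3. *)
Lemma resample_setT : (0 < n)%N ->
  resample [set: 'I_n] <= 12 * expR 3 * \sum_i resample [set i].
Proof.
move=> n0; have := trunc_log_bounds (isT : 1 < 2)%N n0; move: (trunc_log 2 n) => a /=.
set k := (2 ^ a)%N; rewrite expnS -/k => /andP[kn nk].
pose B := [set i : 'I_n | (n - k <= i < (n - k) + k)%N].
have cB : #|B| = #|below k|.
  rewrite card_interval ?subnK //.
  by have := @card_interval 0 k; rewrite add0n => -> //.
have cov : below k :|: B = [set: 'I_n].
  by apply/finset.setP => i; rewrite !inE; have := ltn_ord i; lia.
have nR : 0 < n%:R :> R by rewrite ltr0n.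
pose P := #|{: 'S_n}|%:R : R.
have P0 : 0 < P by rewrite ltr0n; apply/card_gt0P; exists 1%g.
have cst (z : R) : \sum_(s : 'S_n) z = P * z by rewrite sumr_const mulr_natl cardT.
have step : P * resample [set: 'I_n] <= 12 * perm_avg (below k).
  rewrite -cst; apply: (@le_trans _ _ (\sum_(s : 'S_n) 6 *
      (resample (s @: below k) + resample (s @: B)))).
    apply: ler_sum => s _; apply: le_trans (resample_union_triangle _ _).
    suff E1 : s @: [set: 'I_n] = [set: 'I_n] by rewrite -imsetU cov E1.
    by apply/finset.setP => i; rewrite inE -(permKV s i) imset_f.
  rewrite -mulr_sumr big_split /= -/(perm_avg _) -/(perm_avg B) (perm_avg_card cB).
  by rewrite le_eqVlt; apply/orP; left; apply/eqP; ring.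
have one : n%:R * perm_avg (below 1) = P * \sum_i resample [set i].
  transitivity (\sum_(i < n) perm_avg [set i]).
    rewrite -[n in n%:R]card_ord mulr_natl -sumr_const; apply: eq_bigr => i _.
    apply: perm_avg_card; rewrite cards1.
    by have := @card_interval 0 1; rewrite add0n => -> //.
  rewrite exchange_big /= -cst; apply: eq_bigr => s _.
  rewrite [RHS](reindex_inj (@perm_inj _ s)); apply: eq_bigr => i _.
  by rewrite imset_set1.
have pow := perm_avg_pow2 n0 kn.
rewrite -(ler_pM2l P0); apply: (le_trans step).
have -> : P * (12 * expR 3 * \sum_i resample [set i])
    = 12 * (n%:R * expR 3 * perm_avg (below 1)) by rewrite mulrCA -one; ring.
rewrite ler_pM2l // (le_trans pow) // ler_wpM2r ?perm_avg_ge0 // ler_pM ?expR_ge0 ?ler_nat //.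
by rewrite ler_expR ler_pdivrMr // ler_pM2l // ler_nat.
Qed.

End Splice.

(** A path without repeated vertices has fewer than |X| edges, and each edge costs a factor 12: the
    6 of the triangle inequality, doubled for its two terms. *)
Lemma connected_energy (R : realType) (X : finType) (G : sgraph X) (e : X -> X -> R) :
  connected_graph G -> (forall a b, 0 <= e a b) -> (forall a, e a a = 0) ->
  (forall a b c, e a c <= 6 * (e a b + e b c)) ->
  forall a b, e a b <= 12 ^+ #|X| * \sum_a \sum_(b | G a b) e a b.
Proof.
move=> conn e0 eaa tri a b; set D := \sum_a _.
have D0 : 0 <= D by apply: sumr_ge0 => c _; apply: sumr_ge0.
have leD c d : G c d -> e c d <= D.
  move=> cd; rewrite /D (bigD1 c) //= (bigD1 d) //= -addrA lerDl addr_ge0 ?sumr_ge0 //.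
  by move=> ? _; apply: sumr_ge0.
have pathD p c : path G c p -> e c (last c p) <= 12 ^+ size p * D.
  elim: p c => [|d p IH] c /=; first by rewrite eaa expr0 mul1r.
  move=> /andP[cd /IH dp]; apply: (le_trans (tri _ d _)).
  have := leD _ _ cd; rewrite exprS -mulrA.
  have : D <= 12 ^+ size p * D by rewrite ler_peMl // exprn_ege1 // ler1n.
  move: (12 ^+ size p * D) dp => z ? ? ?; lra.
have /connectP[p pp ->] := conn a b.
case: (shortenP pp) => p' pp' up' _; apply: (le_trans (pathD _ _ pp')).
rewrite ler_wpM2r // ler_weXn2l ?ler1n //.
by have := card_uniqP up' => /= /esym szp; apply/ltnW; rewrite szp max_card.
Qed.

(** * Sums over the edges of a cartesian product *)

Section CartprodSum.
Variables (n : nat) (X : finType).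
Local Notation V := {ffun 'I_n -> X}.
Implicit Types (x y z : V) (i : 'I_n) (a b : X).

Definition upd i x b : V := [ffun j => if j == i then b else x j].

Lemma upd_id i x : upd i x (x i) = x.
Proof. by apply/ffunP => j; rewrite ffunE; case: eqP => [->|]. Qed.

Lemma updE i x b : upd i x b i = b.
Proof. by rewrite ffunE eqxx. Qed.

Lemma upd_upd i x a b : upd i (upd i x a) b = upd i x b.
Proof. by apply/ffunP => j; rewrite !ffunE; case: eqP. Qed.

Lemma splice_upd i x u : splice [set i] x u = upd i x (u i).
Proof. by apply/ffunP => j; rewrite !ffunE inE; case: eqP => [->|]. Qed.

Lemma sum_upd (R : realType) i (phi : V -> R) :
  \sum_x \sum_a phi (upd i x a) = #|X|%:R * \sum_x phi x.
Proof.
pose h (q : V * X) := (upd i q.1 q.2, q.1 i).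
have hK : involutive h by move=> [x a]; rewrite /h /= upd_upd upd_id updE.
transitivity (\sum_(x : V) \sum_(a : X) phi x).
  by rewrite !pair_big /= [RHS](reindex_inj (inv_inj hK)).
by rewrite mulr_sumr; apply: eq_bigr => x _; rewrite sumr_const mulr_natl cardT.
Qed.

Lemma sum_cartprod (R : realType) (G : 'I_n -> sgraph X) y (phi : V -> R) :
  \sum_(z | cartprod G y z) phi z
    = \sum_i \sum_(b | G i (y i) b) phi (upd i y b).
Proof.
pose P := [set q : 'I_n * X | G q.1 (y q.1) q.2].
pose h (q : 'I_n * X) := upd q.1 y q.2.
have h_inj : {in P &, injective h}.
  move=> [i b] [j c]; rewrite !inE /h /= => ib jc /ffunP E.
  have yb : y i != b by apply: contraTneq ib => ->; rewrite adj_irr.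
  have := E i; rewrite !ffunE eqxx; case: (eqVneq i j) => [<- ->//|_ bE].
  by rewrite bE eqxx in yb.
transitivity (\sum_(z in h @: P) phi z).
  apply: eq_bigl => z; apply/idP/imsetP => [/existsP[i /andP[Gi /forallP yz]]|[[i b]]].
    exists (i, z i); [by rewrite inE|apply/ffunP => j; rewrite ffunE /=].
    by case: eqP => [->//|/eqP ji]; have /implyP/(_ ji)/eqP := yz j.
  rewrite inE => ib ->; apply/existsP; exists i; rewrite /h updE ib /=.
  by apply/forallP => j; apply/implyP => ji; rewrite ffunE (negbTE ji).
rewrite big_imset //= pair_big_dep /=; apply: eq_bigl => -[i b]; by rewrite inE.
Qed.

End CartprodSum.

Lemma tperm_edges (R : realType) (V : finType) (G : sgraph V) (phi : {perm V} -> R) :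
  \sum_x \sum_(y | G x y) phi (tperm x y) = 2 * \sum_(e in edges G) phi (edge_tperm e).
Proof.
pose h (q : V * V) := [set q.1; q.2].
rewrite pair_big_dep /= (partition_big h (mem (edges G))) /=; last first.
  by move=> q Gq; apply/imsetP; exists q; rewrite ?inE.
rewrite mulr_sumr; apply: eq_bigr => e /imsetP[[x y] /=]; rewrite inE /= => Gxy ->.
have xy : x != y by apply: contraTneq Gxy => ->; rewrite adj_irr.
rewrite edge_tpermE (eq_bigr (fun=> phi (tperm x y))) => [|q /andP[_ /eqP]]; last first.
  by rewrite -!(edge_tpermE x y) -(edge_tpermE q.1 q.2) /h => ->.
rewrite sumr_const mulr_natl; congr (_ *+ _).
rewrite (eq_card (B := [set (x, y); (y, x)])); last first.
  move=> [a b]; rewrite !inE /= /h /= !xpair_eqE.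
  apply/andP/orP => [[Gab /eqP/finset.setP E]|].
    have ab : a != b by apply: contraTneq Gab => ->; rewrite adj_irr.
    have := E a; rewrite !inE eqxx /= => /esym/orP aE.
    have := E b; rewrite !inE eqxx orbT => /esym/orP bE.
    by move: ab; case: aE => /eqP->; case: bE => /eqP->; rewrite ?eqxx //; [left|right].
  by case=> /andP[/eqP-> /eqP->]; rewrite ?Gxy ?(adj_sym G y) ?Gxy // finset.setUC.
by rewrite cards2 xpair_eqE negb_and xy.
Qed.

Lemma cartprod_comparison (R : realType) n (X : finType) (G : 'I_n -> sgraph X)
    (f : {perm {ffun 'I_n -> X}} -> R) :
  (0 < n)%N -> (0 < #|X|)%N -> (forall i, connected_graph (G i)) ->
  \sum_x \sum_y swap_energy f x y
    <= 12 * expR 3 * 12 ^+ #|X| * #|X|%:R * #|{: {ffun 'I_n -> X}}|%:R *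
       \sum_x \sum_(y | cartprod G x y) swap_energy f x y.
Proof.
move=> n0 X0 conn.
have -> : \sum_x \sum_y swap_energy f x y = resample (swap_energy f) [set: 'I_n].
  apply: eq_bigr => x _; apply: eq_bigr => u _; congr swap_energy.
  by apply/ffunP => i; rewrite ffunE inE.
apply: le_trans (resample_setT (swap_energy_ge0 f) (swap_energyxx f) (swap_energyC f)
  (swap_energy_triangle f) (@octopus _ _ f) X0 n0) _.
have c0 : 0 <= 12 * expR 3 :> R by rewrite mulr_ge0 // expR_ge0.
rewrite -!(mulrA (12 * expR 3)); apply: (ler_wpM2l c0).
set K := 12 ^+ #|X|; set N := #|{: {ffun 'I_n -> X}}|%:R.
have K0 : 0 <= K by rewrite exprn_ge0.
have -> : \sum_x \sum_(y | cartprod G x y) swap_energy f x y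
    = \sum_i \sum_(x : {ffun 'I_n -> X}) \sum_(b | G i (x i) b) swap_energy f x (upd i x b).
  by rewrite exchange_big; apply: eq_bigr => x _; exact: sum_cartprod.
rewrite mulr_sumr; apply: ler_sum => i _.
have cst (z : R) : \sum_(u : {ffun 'I_n -> X}) z = N * z by rewrite sumr_const mulr_natl cardT.
apply: (@le_trans _ _ (\sum_(x : {ffun 'I_n -> X}) \sum_(u : {ffun 'I_n -> X}) K * \sum_a \sum_(b | G i a b)
    swap_energy f (upd i x a) (upd i x b))).
  apply: ler_sum => x _; apply: ler_sum => u _; rewrite splice_upd -{1}(upd_id i x).
  apply: (connected_energy (e := fun a b => swap_energy f (upd i x a) (upd i x b))) => //.
  - by move=> a b; exact: swap_energy_ge0.
  - by move=> a; exact: swap_energyxx.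
  - by move=> a b c; exact: swap_energy_triangle.
under eq_bigr do rewrite cst.
rewrite -mulr_sumr -mulr_sumr.
(* The energies along the line through x in direction i do not depend on x_i, so summing over x
   counts each line |X| times. *)
have -> : \sum_(x : {ffun 'I_n -> X}) \sum_a \sum_(b | G i a b) swap_energy f (upd i x a) (upd i x b)
    = #|X|%:R * \sum_(x : {ffun 'I_n -> X}) \sum_(b | G i (x i) b) swap_energy f x (upd i x b).
  rewrite -(sum_upd i); apply: eq_bigr => x _; apply: eq_bigr => a _.
  by rewrite updE; apply: eq_bigr => b _; rewrite upd_upd.
by rewrite le_eqVlt; apply/orP; left; apply/eqP; ring.
Qed.

(** * Functions of few coordinates *)

Section Levels.
Variables (R : realType) (V : finType).
Implicit Types (f h v : {perm V} -> R) (B D T : {set V}) (g s : {perm V}) (x y z m : V).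

Definition fixes D g := [forall (x | x \in D), g x == x].

Lemma fixesP D g : reflect (forall x, x \in D -> g x = x) (fixes D g).
Proof. by apply: (iffP forall_inP) => H x /H /eqP. Qed.

(* Up to normalisation, the conditional expectation of f given the values of the
   permutation on D. *)
Definition psum D f s : R := \sum_(g | fixes D g) f (g * s)%g.

(* f is orthogonal to the functions of k coordinates in B, the coordinates
   outside B being frozen. *)
Definition ort_level B k f := forall D s,
  ~: B \subset D -> #|D :&: B| = k -> psum D f s = 0.

Lemma psumE D f s : psum D f s = dot f (fun s' => (fixes D (s' * s^-1)%g)%:R).
Proof.
rewrite /psum /dot [RHS](reindex_inj (mulIg s)) /= big_mkcond.
by apply: eq_bigr => g _; rewrite mulgK; case: ifP => _; rewrite (mulr1, mulr0).
Qed.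

(** [fixes D (s' * s^-1)] says that s' and s agree on D. These indicators express orthogonality in
    the form [orthc], which the eigenvector lemmas take. *)
Definition level_dual B k (w : {perm V} -> R) := exists D s,
  [/\ ~: B \subset D, #|D :&: B| = k & w = fun s' => (fixes D (s' * s^-1)%g)%:R].

Lemma ort_levelP B k f : orthc (level_dual B k) f <-> ort_level B k f.
Proof.
split=> [H D s BD Dk|H w [D [s [BD Dk ->]]]]; last by rewrite -psumE H.
by rewrite psumE H //; exists D, s.
Qed.

Definition lap B f s : R := \sum_(x in B) \sum_(y in B) (f s - f (tperm x y * s)%g).

Lemma lap_lin B : lin (lap B).
Proof.
move=> a f g; apply/funext => s; rewrite /lap mulr_sumr -big_split.
apply: eq_bigr => x _ /=; rewrite mulr_sumr -big_split.
by apply: eq_bigr => y _ /=; ring.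
Qed.

Lemma dot_lap B f h :
  dot (lap B f) h = \sum_(x in B) \sum_(y in B) (dot f h - dot (ltrans (tperm x y) f) h).
Proof.
rewrite /lap dot_suml; apply: eq_bigr => x _.
rewrite (dot_suml _ _ (fun y s => f s - f (tperm x y * s)%g)); apply: eq_bigr => y _.
by rewrite /dot -sumrB; apply: eq_bigr => s _; rewrite mulrBl.
Qed.

Lemma lap_selfadj B : selfadj (lap B).
Proof.
move=> f h; rewrite [RHS]dotC !dot_lap; apply: eq_bigr => x _.
apply: eq_bigr => y _; rewrite (dotC h f); congr (_ - _).
by rewrite dot_ltrans_tperm dotC.
Qed.

Lemma dot_lapE B f :
  2 * dot (lap B f) f = \sum_(x in B) \sum_(y in B) swap_energy f x y.
Proof.
rewrite dot_lap mulr_sumr; apply: eq_bigr => x _; rewrite mulr_sumr.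
by apply: eq_bigr => y _; rewrite swap_energyE.
Qed.

Lemma fixes_stable B D g x : ~: B \subset D -> fixes D g -> (g x \in B) = (x \in B).
Proof.
move=> /fintype.subsetP BD /fixesP gD; apply/idP/idP; apply: contraLR => xB.
  by rewrite gD // BD // inE.
have gx : g x \in D by rewrite BD // inE.
by rewrite -(perm_inj (gD _ gx)).
Qed.

(** [psum D] sums over permutations that preserve B, and conjugation by these only permutes the
    terms of [lap B]. *)
Lemma psum_lap B D f s : ~: B \subset D ->
  psum D (lap B f) s = lap B (psum D f) s.
Proof.
move=> BD; rewrite /psum /lap.
transitivity (\sum_(x in B) \sum_(g | fixes D g) \sum_(y in B)
    (f (g * s)%g - f (g * (tperm x y * s))%g)); last first.
  by apply: eq_bigr => x _; rewrite exchange_big; apply: eq_bigr => y _; rewrite sumrB.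
rewrite [RHS]exchange_big; apply: eq_bigr => g gD /=.
have Bg x : (g x \in B) = (x \in B) by exact: fixes_stable gD.
rewrite [RHS](reindex_inj (@perm_inj _ g)) /=; apply: eq_big => // x _.
rewrite [RHS](reindex_inj (@perm_inj _ g)) /=; apply: eq_big => // y _.
by rewrite -tpermJ conjgE !mulgA mulgV mul1g.
Qed.

Lemma fixes_mul_tperm D x y g : x \notin D -> y \notin D ->
  fixes D (g * tperm x y)%g = fixes D g.
Proof.
move=> xD yD; apply/fixesP/fixesP => H z zD; have := H z zD; rewrite permM.
  have zx : z != x by apply: contraNneq xD => <-.
  have zy : z != y by apply: contraNneq yD => <-.
  by move/(canRL (tpermK x y)); rewrite tpermD // eq_sym.
by move=> ->; rewrite tpermD //; apply: contraTneq zD => <-.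
Qed.

Lemma psum_swap_out D f x y s : x \notin D -> y \notin D ->
  psum D f (tperm x y * s)%g = psum D f s.
Proof.
move=> xD yD; rewrite /psum [RHS](reindex_inj (mulIg (tperm x y))) /=.
by apply: eq_big => g; [rewrite fixes_mul_tperm|rewrite mulgA].
Qed.

(** A permutation fixing the rest of D sends x to itself or to a point outside D; a transposition
    brings the second case back to the first. *)
Lemma psum_setD1 D f x s : x \in D ->
  psum (D :\ x) f s = psum D f s + \sum_(y in ~: D) psum D f (tperm x y * s)%g.
Proof.
move=> xD; rewrite {1}/psum (partition_big (fun g : {perm V} => g x) (fun y => y \in x |: ~: D)) /=.
  rewrite big_setU1 /= ?inE ?xD //; congr (_ + _).
    apply: eq_bigl => g; apply/andP/fixesP => [[/fixesP H /eqP gx] z zD|H].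
      by have [->//|zx] := eqVneq z x; rewrite H // !inE zx.
    by split; [apply/fixesP => z; rewrite !inE => /andP[_ /H]|rewrite H].
  apply: eq_bigr => y; rewrite inE => yD; rewrite /psum.
  rewrite (reindex_inj (mulIg (tperm x y))) /=; apply: eq_big => g; last by rewrite mulgA.
  have xy : x != y by apply: contraNneq yD => <-.
  rewrite fixes_mul_tperm ?inE ?eqxx ?(negbTE yD) ?andbF //.
  rewrite permM -(inj_eq (@perm_inj _ (tperm x y))) tpermK tpermR.
  apply/andP/fixesP => [[/fixesP H /eqP gx] z zD|H].
    by have [->//|zx] := eqVneq z x; rewrite H // !inE zx.
  by split; [apply/fixesP => z; rewrite !inE => /andP[_ /H]|rewrite H].
move=> g /fixesP gD; rewrite !inE; have [//|gx] := eqVneq (g x) x; rewrite /=.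
apply: contraNN gx => gxD; apply: contraT => gxx.
have := gD (g x); rewrite !inE gxx gxD => /(_ isT)/perm_inj E.
by rewrite E eqxx in gxx.
Qed.

(* The averaged function depends on the coordinates in D only; by psum_setD1,
   each x in D :&: B contributes a full mean-zero sum over the values of the
   x coordinate. *)
Lemma lap_psum B D f s : ~: B \subset D ->
  (forall x s, x \in D :&: B -> psum (D :\ x) f s = 0) ->
  lap B (psum D f) s = (2 * #|D :&: B| * (#|~: D|).+1)%:R * psum D f s
    + lap (D :&: B) (psum D f) s.
Proof.
move=> BD f0; set h := psum D f; pose t x y : R := h s - h (tperm x y * s)%g.
have DB : ~: D \subset B by rewrite -finset.setCS finset.setCK.
have split1 (F : V -> R) : \sum_(x in B) F x
    = \sum_(x in D :&: B) F x + \sum_(x in ~: D) F x.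
  rewrite (big_setID D) /= finset.setIC; congr (_ + _); apply: eq_bigl => x.
  rewrite !inE; have := fintype.subsetP DB x; rewrite inE.
  by case: (x \in D) => //= -> .
have row x : x \in D :&: B -> \sum_(y in ~: D) t x y = (#|~: D|).+1%:R * h s.
  move=> xDB; have := f0 x s xDB; rewrite psum_setD1; last by case/setIP: xDB.
  rewrite -/h => E; rewrite /t sumrB sumr_const -[h s *+ _]mulr_natl -natr1.
  by move: E; set z := \sum_(y in _) _; lra.
have tC x y : t x y = t y x by rewrite /t tpermC.
set c := (#|~: D|).+1 in row *.
have E1 : \sum_(x in D :&: B) \sum_(y in B) t x y
    = lap (D :&: B) h s + #|D :&: B|%:R * (c%:R * h s).
  rewrite mulr_natl -sumr_const -big_split; apply: eq_bigr => x xDB /=.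
  by rewrite split1 (row x xDB).
have E2 : \sum_(x in ~: D) \sum_(y in B) t x y = #|D :&: B|%:R * (c%:R * h s).
  rewrite exchange_big split1 /= [X in _ + X]big1 ?addr0 => [|y]; last first.
    rewrite inE => yD; apply: big1 => x; rewrite inE => xD.
    by rewrite /t /h psum_swap_out // subrr.
  rewrite mulr_natl -sumr_const; apply: eq_bigr => x xDB.
  by rewrite -(row x xDB); apply: eq_bigr.
rewrite [LHS]split1 E1 E2 !natrM; ring.
Qed.

Lemma psum_full B D f s : ~: B \subset D -> #|D :&: B| = #|B| -> psum D f s = f s.
Proof.
move=> BD DB; have DT x : x \in D.
  have [xB|xB] := boolP (x \in B); last by rewrite (fintype.subsetP BD) // inE.
  have /eqP E : D :&: B == B by rewrite eqEcard finset.subsetIr DB leqnn.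
  by move: xB; rewrite -{1}E inE => /andP[].
rewrite /psum (big_pred1 1%g) ?mul1g // => g.
apply/fixesP/eqP => [H|->]; last by move=> x _; rewrite perm1.
by apply/permP => x; rewrite perm1 H.
Qed.

Lemma card_setC_level B D : ~: B \subset D -> #|~: D| = (#|B| - #|D :&: B|)%N.
Proof.
move=> BD; rewrite finset.setIC -cardsD; apply: eq_card => x; rewrite !inE.
by have := fintype.subsetP BD x; rewrite !inE; case: (x \in B) => [_|/(_ isT) ->]; rewrite ?andbT ?andbF.
Qed.

Lemma ort_level_lap B k f : ort_level B k f -> ort_level B k (lap B f).
Proof.
move=> H D s BD Dk; rewrite psum_lap // /lap big1 // => x xB; rewrite big1 // => y yB.
by rewrite !H // subrr.
Qed.

(** Take v of least eigenvalue mu among functions orthogonal to level k - 1, and j the least level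
    from k on to which v is not orthogonal. Some average [psum D v] over j coordinates of B is then
    a nonzero eigenfunction for mu, and v is orthogonal to level j - 1, so [lap_psum] bounds mu from
    below. *)
Lemma lap_eigen_level B k f : (0 < k <= #|B|)%N -> ort_level B k.-1 f -> f <> (fun=> 0) ->
  exists mu j v, [/\ (k <= j <= #|B|)%N, ort_level B j.-1 v, v <> (fun=> 0),
    lap B v = (fun s => mu * v s) &
    (2 * j * (#|B| - j).+1)%:R <= mu /\ mu * dot f f <= dot (lap B f) f].
Proof.
move=> /andP[k0 kB] fk f0.
have [|||mu [v [/ort_levelP vk v0 Av mumin]]] :=
  @min_eigenvector _ _ (level_dual B k.-1) (lap B) f (lap_lin B) (@lap_selfadj B).
- by move=> h /ort_levelP hk; apply/ort_levelP; exact: ort_level_lap.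
- exact/ort_levelP.
- exact: f0.
have exj : exists j, (k <= j <= #|B|)%N && `[< ~ ort_level B j v >].
  exists #|B|; rewrite kB leqnn; apply/asboolP => H; apply: v0.
  by apply/funext => s; rewrite -(@psum_full B [set: V] v s) ?H ?finset.subsetT ?finset.setTI.
pose j := ex_minn exj; case: (ex_minnP exj) => {}j /andP[/andP[kj jB] /asboolP vj] jmin.
have vj1 : ort_level B j.-1 v.
  have [<-//|] := eqVneq k j; move=> kj'; apply: contrapT => H.
  have : (j <= j.-1)%N by apply: jmin; apply/andP; split; [lia|exact/asboolP].
  lia.
exists mu, j, v; split => //; first by rewrite kj.
split; last by apply: mumin; exact/ort_levelP.
have [D [s [BD Dj h0]]] : exists D s, [/\ ~: B \subset D, #|D :&: B| = j & psum D v s <> 0].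
  move/existsNP: vj => [D /existsNP[s /not_implyP[BD /not_implyP[Dj hs]]]].
  by exists D, s.
pose h := psum D v.
have lh : lap B h = fun s => mu * h s.
  by apply/funext => s'; rewrite -psum_lap // Av /h /psum mulr_sumr.
have hpos : 0 < dot h h by apply: dot_gt0 => /funeqP /(_ s).
have lh2 : lap B h = fun s => (2 * j * (#|B| - j).+1)%:R * h s + lap (D :&: B) h s.
  apply/funext => s'; rewrite lap_psum //; first by rewrite (card_setC_level BD) Dj.
  move=> x s2 /setIP[xD xB]; apply: vj1.
    apply/fintype.subsetP => y yB; rewrite !inE (fintype.subsetP BD) // andbT.
    by apply: contraTneq yB => ->; rewrite inE negbK.
  by rewrite finset.setIDAC -Dj (cardsD1 x (D :&: B)) !inE xD xB.
rewrite -(ler_pM2r hpos) -[leRHS]dotZl -lh lh2 dotDZl lerDl.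
have := dot_lapE (D :&: B) h; rewrite -(@pmulr_rge0 _ 2) // => ->.
by apply: sumr_ge0 => x _; apply: sumr_ge0 => y _; exact: swap_energy_ge0.
Qed.

Lemma ort_level_setD1 B k f m : m \in B -> ort_level B k.+1 f -> ort_level (B :\ m) k f.
Proof.
move=> mB H D s; rewrite finset.setCD => /finset.subUsetP[BD]; rewrite finset.sub1set => mD Dk.
apply: H => //; rewrite (cardsD1 m) inE mD mB -Dk; congr (_ + _)%N.
by rewrite finset.setIDA.
Qed.

(** Each pair of distinct points survives |B| - 2 of the |B| deletions. *)
Lemma sum_swap_setD1 B f : (2 <= #|B|)%N ->
  \sum_(m in B) \sum_(x in B :\ m) \sum_(y in B :\ m) swap_energy f x y
    = (#|B| - 2)%:R * \sum_(x in B) \sum_(y in B) swap_energy f x y.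
Proof.
move=> B2; set Z := \sum_(x in B) \sum_(y in B) swap_energy f x y.
have Em m : m \in B -> \sum_(x in B :\ m) \sum_(y in B :\ m) swap_energy f x y
    = Z - 2 * \sum_(y in B) swap_energy f m y.
  move=> mB; pose r x := \sum_(y in B) swap_energy f x y.
  have rE x : r x = swap_energy f x m + \sum_(y in B :\ m) swap_energy f x y.
    by rewrite /r (big_setD1 m).
  have ZE : Z = r m + \sum_(x in B :\ m) r x by rewrite /Z (big_setD1 m).
  have rm : r m = \sum_(x in B :\ m) swap_energy f x m.
    by rewrite rE swap_energyxx add0r; apply: eq_bigr => x _; rewrite swap_energyC.
  rewrite ZE (eq_bigr _ (fun x _ => rE x)) big_split /= -rm -/(r m).
  by set z := \sum_(x in _) _; ring.
rewrite (eq_bigr _ Em) sumrB sumr_const -mulr_sumr -/Z natrB //.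
by rewrite -[Z *+ _]mulr_natl; ring.
Qed.

(** The eigenvalue bound of [lap_eigen_level] is only linear in |B| when j is close to |B|. When 2 j
    exceeds |B|, a point of B is deleted and the inequality is averaged over that point: the size
    and the level both drop by one, which preserves the hypothesis, and the average reproduces |B|
    (|B| - 1) without loss. *)
Lemma level_gap B k f : (0 < k <= #|B|)%N -> (#|B| <= 2 * k)%N ->
  ort_level B k.-1 f ->
  (#|B| * #|B|.-1)%:R * dot f f <= \sum_(x in B) \sum_(y in B) swap_energy f x y.
Proof.
move Eb : #|B| => b; elim: b B k f Eb => [|b IH] B k f Bb kb b2k fk.
  rewrite mul0n mul0r; apply: sumr_ge0 => x _; apply: sumr_ge0 => y _.
  exact: swap_energy_ge0.
have [->|f0] := pselect (f = fun=> 0).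
  rewrite dot0l mulr0; apply: sumr_ge0 => x _; apply: sumr_ge0 => y _.
  exact: swap_energy_ge0.
have kB : (0 < k <= #|B|)%N by rewrite Bb.
have [mu [j [v [/andP[kj jB] vj v0 Av [muj muf]]]]] := lap_eigen_level kB fk f0.
rewrite Bb in jB muj.
have vpos := dot_gt0 v0; have fpos := dot_gt0 f0.
suff : (b.+1 * b)%:R <= 2 * mu.
  by rewrite -dot_lapE -(ler_pM2r fpos) => /le_trans; apply; rewrite -mulrA ler_pM2l.
have [small|large] := leqP (2 * j) b.+1.
  apply: (@le_trans _ _ (2 * (2 * j * (b.+1 - j).+1)%:R)); last by rewrite ler_pM2l.
  rewrite -natrM ler_nat; nia.
(* Here b is |B| - 1, and averaging over the deletions divides by b - 1. *)
have [b2|b2] := leqP b 1.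
  apply: (@le_trans _ _ (2 * (2 * j * (b.+1 - j).+1)%:R)); last by rewrite ler_pM2l.
  rewrite -natrM ler_nat; nia.
have B2 : (2 <= #|B|)%N by rewrite Bb ltnS ltnW.
have := sum_swap_setD1 v B2; rewrite -dot_lapE Av dotZl Bb => sumE.
have step : \sum_(m in B) (b * b.-1)%:R * dot v v
    <= \sum_(m in B) \sum_(x in B :\ m) \sum_(y in B :\ m) swap_energy v x y.
  apply: ler_sum => m mB; apply: (IH _ j.-1); try lia.
    by move: Bb; rewrite (cardsD1 m) mB => -[].
  by apply: ort_level_setD1 => //; rewrite (_ : j.-1.-1.+1 = j.-1) //; lia.
move: step; rewrite sumE sumr_const Bb -[leLHS]mulr_natl (_ : b.+1 - 2 = b.-1)%N; last lia.
have bpos : 0 < b.-1%:R * dot v v by rewrite mulr_gt0 // ltr0n; lia.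
move=> H; rewrite -(ler_pM2r bpos).
have -> : (b.+1 * b)%:R * (b.-1%:R * dot v v) = b.+1%:R * ((b * b.-1)%:R * dot v v).
  by rewrite !natrM; ring.
by apply: (le_trans H); rewrite le_eqVlt; apply/orP; left; apply/eqP; ring.
Qed.

(** For 2 j <= |V| the eigenvalue bound 2 j (|V| - j + 1) is at least j |V|. For larger j,
    [level_gap] gives |V| (|V| - 1), which is enough because k <= |V|. *)
Lemma level_gap_linear k f : (2 <= #|V|)%N -> (0 < k <= #|V|)%N ->
  ort_level [set: V] k.-1 f ->
  k%:R * #|V|%:R / 2 * dot f f <= \sum_x \sum_y swap_energy f x y.
Proof.
move=> V2 kV fk; have VT : #|[set: V]| = #|V| by rewrite cardsT.
have EE (h : {perm V} -> R) : \sum_x \sum_y swap_energy h x y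
    = \sum_(x in [set: V]) \sum_(y in [set: V]) swap_energy h x y.
  by apply: eq_big => [x|x _]; rewrite ?inE //; apply: eq_bigl => y; rewrite inE.
have [->|f0] := pselect (f = fun=> 0).
  rewrite dot0l mulr0; apply: sumr_ge0 => x _; apply: sumr_ge0 => y _.
  exact: swap_energy_ge0.
have kB : (0 < k <= #|[set: V]|)%N by rewrite VT.
have [mu [j [v [/andP[kj jB] vj v0 Av [muj muf]]]]] := lap_eigen_level kB fk f0.
rewrite VT in jB muj.
have vpos := dot_gt0 v0; have fpos := dot_gt0 f0.
rewrite EE -dot_lapE; apply: (@le_trans _ _ (2 * (mu * dot f f))); last by rewrite ler_pM2l.
rewrite mulrA ler_pM2r // ler_pdivrMr // -natrM.
have [small|large] := leqP (2 * j) #|V|.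
  apply: (@le_trans _ _ (2 * (2 * j * (#|V| - j).+1)%:R * 2)).
    rewrite -!natrM ler_nat; nia.
  by rewrite ler_pM2r // ler_pM2l.
have := level_gap (B := [set: V]) (k := j); rewrite VT => /(_ v).
rewrite -dot_lapE Av dotZl mulrA ler_pM2r // => H.
apply: (@le_trans _ _ ((#|V| * #|V|.-1)%:R * 2)).
  rewrite -natrM ler_nat; nia.
rewrite ler_pM2r // H //; lia.
Qed.

End Levels.

(** * The semigroup of a finite generator *)

Lemma is_derive_sumr (R : realType) (I : Type) (r : seq I) (u : I -> R -> R) (du : I -> R) (t : R) :
  (forall i, is_derive t 1 (u i) (du i)) ->
  is_derive t 1 (fun t => \sum_(i <- r) u i t) (\sum_(i <- r) du i).
Proof.
move=> H; elim: r => [|i r IH].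
  by under eq_fun do rewrite big_nil; rewrite big_nil; exact: is_derive_cst.
by under eq_fun do rewrite big_cons; rewrite big_cons; exact: is_deriveD.
Qed.

Lemma is_derive_expRM (R : realType) (k t : R) :
  is_derive t 1 (fun t => expR (k * t)) (k * expR (k * t)).
Proof.
have H : is_derive t 1 (fun t : R => k * t) k.
  by apply: is_derive_eq; exact: mulr1.
by have := is_derive1_comp (is_derive_expR (k * t)) H; rewrite /comp /= mulrC.
Qed.

Lemma gronwall (R : realType) (k : R) (phi dphi : R -> R) :
  (forall t : R, is_derive t (1 : R) phi (dphi t)) -> (forall t : R, 0 <= t -> dphi t <= - k * phi t) ->
  forall t : R, 0 <= t -> phi t <= expR (- k * t) * phi 0.
Proof.
move=> dp le t t0; pose psi t := expR (k * t) * phi t.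
have dpsi (x : R) : is_derive x (1 : R) psi (expR (k * x) * (k * phi x + dphi x)).
  apply: (is_derive_eq (is_deriveM (is_derive_expRM k x) (dp x))).
  by rewrite /GRing.scale /=; ring.
have : psi t <= psi 0.
  apply: (@ler0_derive1_nincry _ psi 0) => //.
  - move=> x; rewrite in_itv /= andbT => x0; have [_ dx] := dpsi x; rewrite derive1E dx.
    by rewrite mulr_ge0_le0 ?expR_ge0 //; have := le x (ltW x0); lra.
  - apply: continuous_subspaceT => x; apply: differentiable_continuous.
    by apply/derivable1_diffP; have [dx _] := dpsi x; exact: dx.
rewrite /psi mulr0 expR0 mul1r mulNr expRN => H.
by rewrite -ler_pdivrMl ?invrK // invr_gt0 expR_gt0.
Qed.

Section Exponential.
Variables (R : realType) (S : finType) (L : (S -> R) -> S -> R).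
Hypothesis lL : lin L.
Implicit Types (f g : S -> R) (s : S) (t : R).

Lemma lin_iter k : lin (iter k L).
Proof. by elim: k => [|k IH] a f g //=; rewrite IH lL. Qed.

Let M : R := \sum_s \sum_t `|L (dirac_fun R t) s|.

Lemma iter_bound f b : 0 <= b -> (forall s, `|f s| <= b) ->
  forall k s, `|iter k L f s| <= M ^+ k * b.
Proof.
move=> b0 fb; elim=> [|k IH] s; first by rewrite mul1r.
rewrite iterS lin_dirac // (le_trans (ler_norm_sum _ _ _)) //.
apply: (@le_trans _ _ (\sum_t (M ^+ k * b) * `|L (dirac_fun R t) s|)).
  by apply: ler_sum => t _; rewrite normrM ler_wpM2r.
rewrite -mulr_sumr exprS -[leRHS]mulrA [leRHS]mulrC ler_wpM2l //.
  by rewrite mulr_ge0 // exprn_ge0 // sumr_ge0 // => ? _; rewrite sumr_ge0.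
by rewrite /M [leRHS](bigD1 s) //= lerDl sumr_ge0 // => ? _; rewrite sumr_ge0.
Qed.

Lemma is_cvg_expgen_lin f t s : cvgn [series t ^+ k / k`!%:R * iter k L f s]_k.
Proof.
pose b := \sum_s `|f s|.
have fb s' : `|f s'| <= b by rewrite /b (bigD1 s') //= lerDl sumr_ge0.
have M0 : 0 <= M by rewrite /M sumr_ge0 // => ? _; rewrite sumr_ge0.
apply: normed_cvg.
apply: (@series_le_cvg _ _ (fun k => exp_coeff (`|t| * M) k * b)) => [k|k|k|].
- exact: normr_ge0.
- by rewrite mulr_ge0 ?exp_coeff_ge0 ?mulr_ge0 // (le_trans _ (fb s)).
- rewrite /= !normrM normfV normrX normr_nat /exp_coeff /= exprMn.
  rewrite mulrAC [leRHS]mulrAC ler_wpM2r ?invr_ge0 // -mulrA.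
  by rewrite ler_wpM2l ?exprn_ge0 // iter_bound // (le_trans _ (fb s)).
have -> : series (fun k => exp_coeff (`|t| * M) k * b)
        = b *: series (exp_coeff (`|t| * M)) :> (R ^nat).
  by rewrite funeqE => n; rewrite /series /= -mulr_suml mulrC.
apply: is_cvgZl_tmp; exact: is_cvg_series_exp_coeff.
Qed.

Lemma is_derive_expgen f t s :
  is_derive t 1 (fun t => expgen L t f s) (expgen L t (L f) s).
Proof.
pose c g k : R := (k`!%:R)^-1 * iter k L g s.
have seriesE g t' : [series t' ^+ k / k`!%:R * iter k L g s]_k = pseries (c g) t'.
  by congr series; apply/funext => k /=; rewrite /c -mulrA mulrC.
have cvgc g t' : cvgn (pseries (c g) t') by rewrite -seriesE; exact: is_cvg_expgen_lin.
have dE g : pseries_diffs (c g) = c (L g).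
  apply/funext => k; rewrite /pseries_diffs /c -iterSr factS natrM invfM !mulrA.
  by rewrite divff ?pnatr_eq0 // mul1r.
have tt1 : `|t| < `| `|t| + 1|.
  by rewrite (@ger0_norm _ (`|t| + 1)) ?ltrDl // addr_ge0.
have := @pseries_snd_diffs R (c f) (`|t| + 1) t; rewrite !dE /expgen seriesE.
have -> : (fun u => limn [series u ^+ k / k`!%:R * iter k L f s]_k)
   = (fun u => limn (pseries (c f) u)) by apply/funext => u; rewrite seriesE.
by apply.
Qed.

Lemma dot_expgen f g t : dot (expgen L t f) g
  = limn [series t ^+ k / k`!%:R * dot (iter k L f) g]_k.
Proof.
apply/esym/cvg_lim => //.
have -> : [series t ^+ k / k`!%:R * dot (iter k L f) g]_k
    = fun n => \sum_s [series t ^+ k / k`!%:R * iter k L f s]_k n * g s.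
  apply/funext => n; rewrite /series /=; under [RHS]eq_bigr do rewrite mulr_suml.
  rewrite exchange_big /=; apply: eq_bigr => k _; rewrite mulr_sumr.
  by apply: eq_bigr => s _; rewrite mulrA.
rewrite /dot; elim: (index_enum S) => [|s r IH].
  by under eq_fun do rewrite big_nil; rewrite big_nil; exact: cvg_cst.
under eq_fun do rewrite big_cons; rewrite big_cons; apply: cvgD => //.
by apply: cvgMr_tmp; exact: is_cvg_expgen_lin.
Qed.

Lemma expgen_lin t : lin (expgen L t).
Proof.
move=> a f g; apply/funext => s; apply: cvg_lim => //.
have -> : [series t ^+ k / k`!%:R * iter k L (fun s => a * f s + g s) s]_k
  = fun n => a * [series t ^+ k / k`!%:R * iter k L f s]_k n
     + [series t ^+ k / k`!%:R * iter k L g s]_k n.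
  apply/funext => n; rewrite /series /= mulr_sumr -big_split.
  by apply: eq_bigr => k _ /=; rewrite lin_iter; ring.
apply: cvgD; last exact: is_cvg_expgen_lin.
by apply: cvgMl_tmp; exact: is_cvg_expgen_lin.
Qed.

Lemma expgen0 f : expgen L 0 f = f.
Proof.
apply/funext => s; apply: cvg_lim => //; apply: cvg_near_cst.
near=> n; have [m ->] : exists m, n = m.+1.
  by exists n.-1; rewrite prednK //; near: n; exists 1%N.
rewrite /series /= big_nat_recl //= expr0 fact0 divr1 mul1r big1 ?addr0 // => k _.
by rewrite expr0n /= !mul0r.
Unshelve. all: by end_near. Qed.

Lemma expgen_comm f t : expgen L t (L f) = L (expgen L t f).
Proof.
apply/funext => s; rewrite [in RHS]lin_dirac // -/(dot _ (fun r : S => L (dirac_fun R r) s)).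
rewrite -(dot_dirac (expgen L t (L f)) s) !dot_expgen; congr (limn (series _)).
apply/funext => k; by rewrite /= dot_dirac -iterSr iterS [in LHS]lin_dirac.
Qed.

Lemma expgen_selfadj t : selfadj L -> selfadj (expgen L t).
Proof.
move=> sL f g; rewrite dot_expgen [RHS]dotC dot_expgen; congr (limn (series _)).
apply/funext => k; congr (_ * _); rewrite [RHS]dotC.
by elim: k f g => [//|k IH] f g; rewrite iterS iterSr sL IH.
Qed.

Lemma expgen_orthc (W : (S -> R) -> Prop) t f :
  (forall f, orthc W f -> orthc W (L f)) -> orthc W f -> orthc W (expgen L t f).
Proof.
move=> stW fW w Ww; rewrite dot_expgen.
have itW k : orthc W (iter k L f) by elim: k => //= k; exact: stW.
apply: cvg_lim => //; have -> : [series t ^+ k / k`!%:R * dot (iter k L f) w]_k = fun=> 0.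
  by apply/funext => n; rewrite /series /= big1 // => k _; rewrite (itW k w Ww) mulr0.
exact: cvg_cst.
Qed.

Lemma expgen_eigen t c f : L f = (fun s => c * f s) ->
  expgen L t f = fun s => expR (c * t) * f s.
Proof.
move=> Lf; apply/funext => s; apply: cvg_lim => //.
have itf k : iter k L f = fun s => c ^+ k * f s.
  elim: k => [|k IH]; first by apply/funext => s'; rewrite mul1r.
  by rewrite iterS IH linZ // Lf; apply/funext => s'; rewrite exprSr mulrA.
have -> : [series t ^+ k / k`!%:R * iter k L f s]_k = fun n => series (exp_coeff (c * t)) n * f s.
  apply/funext => n; rewrite /series /= mulr_suml; apply: eq_bigr => k _.
  by rewrite itf /exp_coeff /= exprMn; ring.
by apply: cvgMr_tmp; exact: is_cvg_series_exp_coeff.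
Qed.

Lemma expgen_ge_init t f s : 0 <= t -> (forall k s, 0 <= iter k L f s) -> f s <= expgen L t f s.
Proof.
move=> t0 f0; apply: limr_ge; first exact: is_cvg_expgen_lin.
near=> n; have [m ->] : exists m, n = m.+1.
  by exists n.-1; rewrite prednK //; near: n; exists 1%N.
rewrite /series /= big_nat_recl //= expr0 fact0 divr1 mul1r lerDl sumr_ge0 // => k _.
by apply: mulr_ge0; [apply: mulr_ge0; rewrite ?invr_ge0 ?exprn_ge0|exact: (f0 k.+1)].
Unshelve. all: by end_near. Qed.

(** Stated for any solution of u' = L u: it serves the semigroup itself and, with c = 0, the
    difference of two solutions, where it yields uniqueness. *)
Lemma flow_decay (c : R) (u : R -> S -> R) :
  (forall (t : R) s, is_derive t (1 : R) (fun t => u t s) (L (u t) s)) ->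
  (forall t, 0 <= t -> dot (L (u t)) (u t) <= - c * dot (u t) (u t)) ->
  forall t, 0 <= t -> dot (u t) (u t) <= expR (- (2 * c) * t) * dot (u 0) (u 0).
Proof.
move=> du le; apply: (@gronwall _ (2 * c) (fun t => dot (u t) (u t))
  (fun t => 2 * dot (L (u t)) (u t))) => [t|t t0].
  rewrite /dot mulr_sumr; apply: is_derive_sumr => s.
  apply: (is_derive_eq (is_deriveM (du t s) (du t s))).
  by rewrite /GRing.scale /=; ring.
by have := le t t0; lra.
Qed.

Lemma expgen_decay (W : (S -> R) -> Prop) (c : R) f t :
  (forall f, orthc W f -> orthc W (L f)) ->
  (forall f, orthc W f -> dot (L f) f <= - c * dot f f) ->
  orthc W f -> 0 <= t ->
  dot (expgen L t f) (expgen L t f) <= expR (- (2 * c) * t) * dot f f.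
Proof.
move=> stW gap fW t0; rewrite -[in leRHS](expgen0 f).
apply: (@flow_decay c (fun t => expgen L t f)) => // [u s|u u0].
  by rewrite -expgen_comm; exact: is_derive_expgen.
by apply: gap; exact: expgen_orthc.
Qed.

End Exponential.

(** Both sides solve u' = L u with the same initial value. The form of L is nonpositive, so the norm
    of their difference does not increase and stays zero. *)
Lemma expgen_shift (R : realType) (S : finType) (Q : (S -> R) -> S -> R) (c t : R) (f : S -> R) :
  lin Q -> (forall g, dot (Q g) g <= c * dot g g) -> 0 <= t ->
  expgen (fun g s => Q g s - c * g s) t f = fun s => expR (- c * t) * expgen Q t f s.
Proof.
move=> lQ Qc t0; set L := fun g s => _.
have lL : lin L by move=> a g h; rewrite /L lQ; apply/funext => s; ring.
have dL g : dot (L g) g = dot (Q g) g - c * dot g g.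
  rewrite -mulNr -dotZl /dot -big_split.
  by apply: eq_bigr => s _ /=; rewrite /L; ring.
pose u t s := (-1) * expgen L t f s + expR (- c * t) * expgen Q t f s.
have := @flow_decay _ _ L 0 u _ _ t t0; rewrite mulr0 oppr0 mul0r expR0 mul1r.
move=> H; have u0 : dot (u t) (u t) <= dot (u 0) (u 0).
  apply: H => [t' s|t' t'0]; last first.
    by have := Qc (u t'); rewrite dL; lra.
  rewrite /u (lL (-1) (expgen L t' f) (fun s => expR (- c * t') * expgen Q t' f s)).
  rewrite (linZ _ _ lL) -expgen_comm //.
  apply: (is_derive_eq (is_deriveD (is_deriveM (is_derive_cst (-1 : R) t' (1 : R))
     (is_derive_expgen lL f t' s))
     (is_deriveM (is_derive_expRM (- c) t') (is_derive_expgen lQ f t' s)))).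
  by rewrite /GRing.scale /= (expgen_comm lQ) /L; ring.
have : dot (u t) (u t) = 0.
  apply/eqP; rewrite eq_le dot_ge0 andbT (le_trans u0) // /u.
  rewrite (_ : (fun s => _) = fun=> 0) ?dot0l //.
  by apply/funext => s; rewrite !expgen0 // mulr0 expR0; ring.
by move/dot_eq0/funeqP => E; apply/funext => s; have := E s; rewrite /u; lra.
Qed.

(** * Upper bound on the mixing time *)

Section Projection.
Variables (R : realType) (S : finType).
Implicit Types (f g h : S -> R).

Lemma dot_CS f g : dot f g ^+ 2 <= dot f f * dot g g.
Proof.
have [->|/dot_gt0 g0] := pselect (g = fun=> 0); first by rewrite !(dotC _ (fun=> 0)) !dot0l mulr0 expr0n.
have := dot_ge0 (fun s => dot g g * f s + (- dot f g) * g s).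
rewrite !(dotDZl, dotDZr, dotZl, dotZr) (dotC g f) => H.
have : 0 <= dot g g * (dot f f * dot g g - dot f g ^+ 2).
  by apply: le_trans H _; rewrite le_eqVlt; apply/orP; left; apply/eqP; ring.
by rewrite pmulr_rge0 // subr_ge0.
Qed.

Lemma gram_schmidt (w : nat -> S -> R) m :
  exists r (e : nat -> S -> R), [/\ (r <= m)%N,
    (forall i j, (i < r)%N -> (j < r)%N -> dot (e i) (e j) = (i == j)%:R) &
    forall f, (forall i, (i < r)%N -> dot f (e i) = 0) <->
              (forall i, (i < m)%N -> dot f (w i) = 0)].
Proof.
elim: m => [|m [r [e [rm on eq]]]]; first by exists 0%N, (fun _ _ => 0).
pose p s := 1 * w m s + (- 1) * \sum_(i < r) dot (w m) (e i) * e i s.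
have dotp f : dot p f = dot (w m) f - \sum_(i < r) dot (w m) (e i) * dot (e i) f.
  rewrite /p dotDZl dotZl mul1r mulN1r (dot_suml _ _ (fun (i : 'I_r) s => dot (w m) (e i) * e i s)).
  by congr (_ - _); apply: eq_bigr => i _; rewrite dotZl.
have pe j : (j < r)%N -> dot p (e j) = 0.
  move=> jr; rewrite dotp (bigD1 (Ordinal jr)) //= on // eqxx mulr1 big1 ?addr0 ?subrr //.
  by move=> i ij; rewrite on // (_ : (i == j :> nat) = false) ?mulr0 //; exact/negbTE.
have split_lt (P : nat -> Prop) n : (forall i, (i < n.+1)%N -> P i) <-> (forall i, (i < n)%N -> P i) /\ P n.
  split=> [H|[H Pn] i]; first by split=> [i /ltnW|]; exact: H.
  by rewrite ltnS leq_eqVlt => /predU1P[->//|/H].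
have pf f : (forall i, (i < r)%N -> dot f (e i) = 0) -> dot f p = dot f (w m).
  move=> fe; rewrite dotC dotp big1 ?subr0 1?dotC // => i _.
  by rewrite dotC (dotC _ f) fe // mulr0.
have [p0|/dot_gt0 p0] := pselect (p = fun=> 0).
  exists r, e; split; [exact: leqW|exact: on|] => f.
  rewrite split_lt -eq; split=> [fe|[]//]; split => //.
  by rewrite -pf // p0 dotC dot0l.
pose z := Num.sqrt (dot p p); have z0 : 0 < z by rewrite sqrtr_gt0.
have zz : z * z = dot p p by rewrite -expr2 sqr_sqrtr // ltW.
pose e' i := if i == r then fun s => z^-1 * p s else e i.
have e'lt i : (i < r)%N -> e' i = e i by move=> ir; rewrite /e' ltn_eqF.
have e'r : e' r = fun s => z^-1 * p s by rewrite /e' eqxx.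
exists r.+1, e'; split; first by rewrite ltnS.
  move=> i j; rewrite !ltnS [(i <= r)%N]leq_eqVlt [(j <= r)%N]leq_eqVlt.
  move=> /predU1P[->|ir] /predU1P[->|jr].
  - by rewrite e'r eqxx dotZl dotZr -zz -[RHS]/(1 : R); field; rewrite gt_eqF.
  - by rewrite e'r e'lt // dotZl pe // mulr0 gtn_eqF.
  - by rewrite e'r e'lt // dotC dotZl pe // mulr0 ltn_eqF.
  - by rewrite !e'lt // on.
move=> f; rewrite !split_lt -eq; split=> [[fe fr]|[fe fw]].
  have fe0 i : (i < r)%N -> dot f (e i) = 0 by move=> ir; rewrite -e'lt // fe.
  split => //; rewrite -pf //; move: fr; rewrite e'r dotZr => /eqP.
  by rewrite mulf_eq0 invr_eq0 gt_eqF //= => /eqP.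
by split=> [i ir|]; [rewrite e'lt // fe|rewrite e'r dotZr pf // fw mulr0].
Qed.

(** In finite dimension this is the linear span of W. *)
Definition biorthc (W : (S -> R) -> Prop) f := forall h, orthc W h -> dot h f = 0.

(* The trace bound: the squared norms of the projections of the point masses
   add up to the dimension of the space. *)
Lemma projection (I : finType) (F : I -> S -> R) :
  exists P : S -> S -> R,
  [/\ forall t, orthc (fun w => exists i, w = F i) (fun s => dirac_fun R t s - P t s),
      forall t, biorthc (fun w => exists i, w = F i) (P t) &
      \sum_t dot (P t) (P t) <= #|I|%:R].
Proof.
pose w k := if insub k is Some i then F (enum_val (i : 'I_#|I|)) else fun=> 0.
have wE (i : 'I_#|I|) : w i = F (enum_val i) by rewrite /w valK.
have [r [e [rm on eq]]] := gram_schmidt w #|I|.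
have orthE f : orthc (fun w => exists i, w = F i) f <-> forall i, (i < r)%N -> dot f (e i) = 0.
  rewrite eq; split=> [H i im|H _ [i ->]].
    by rewrite -[i]/(val (Ordinal im)) wE H //; eexists.
  by rewrite -(enum_rankK i) -wE; apply: H.
pose P t s := \sum_(i < r) e i t * e i s.
have PE t h : dot (P t) h = \sum_(i < r) e i t * dot (e i) h.
  by rewrite (dot_suml _ _ (fun (i : 'I_r) s => e i t * e i s)); apply: eq_bigr => i _; rewrite dotZl.
have PeE t j : (j < r)%N -> dot (P t) (e j) = e j t.
  move=> jr; rewrite PE (bigD1 (Ordinal jr)) //= on // eqxx mulr1 big1 ?addr0 //.
  by move=> i ij; rewrite on // (_ : (i == j :> nat) = false) ?mulr0 //; exact/negbTE.
exists P; split.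
- move=> t; apply/orthE => j jr.
  have -> : (fun s => dirac_fun R t s - P t s) = (fun s => (-1) * P t s + dirac_fun R t s).
    by apply/funext => s; ring.
  by rewrite dotDZl PeE // (dotC (dirac_fun R t)) dot_dirac; ring.
- move=> t h /orthE hW; rewrite dotC PE big1 // => i _.
  by rewrite dotC hW // mulr0.
rewrite (eq_bigr (fun t => \sum_(i < r) e i t * e i t)) => [|t _]; last first.
  by rewrite PE; apply: eq_bigr => i _; rewrite dotC PeE.
rewrite exchange_big /= (eq_bigr (fun=> 1)) => [|i _]; last first.
  by have := on i i (ltn_ord i) (ltn_ord i); rewrite eqxx.
by rewrite sumr_const card_ord ler_nat.
Qed.

End Projection.

(** * Projections of point masses on functions of k coordinates *)

Section LevelProjection.
Variables (R : realType) (V : finType).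
Implicit Types (f h : {perm V} -> R) (s a : {perm V}).
Local Notation N := #|V|.
Local Notation W k := (@level_dual R V [set: V] k).

Lemma ort_level_rtrans k f a :
  ort_level [set: V] k f -> ort_level [set: V] k (fun s => f (s * a)%g).
Proof.
move=> H D s BD Dk; rewrite -(H D (s * a)%g BD Dk) /psum.
by apply: eq_bigr => g _; rewrite mulgA.
Qed.

Lemma ort_levelD k f h : ort_level [set: V] k f -> ort_level [set: V] k h ->
  ort_level [set: V] k (fun s => (-1) * f s + h s).
Proof.
move=> /ort_levelP Hf /ort_levelP Hh; apply/ort_levelP => w Ww.
by rewrite dotDZl Hf // Hh // mulr0 addr0.
Qed.

Lemma ort_level_pred k f : (0 < k <= N)%N -> ort_level [set: V] k f -> ort_level [set: V] k.-1 f.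
Proof.
move=> /andP[k0 kN] H D s BD; rewrite finset.setIT => Dk.
have [x xD] : exists x, x \notin D.
  apply/existsP; rewrite -negb_forall; apply/forallP => DT.
  have : (#|V| <= #|D|)%N by rewrite -cardsT; apply/subset_leq_card/fintype.subsetP.
  by rewrite Dk; lia.
have Hk s' : psum (x |: D) f s' = 0.
  apply: H; first by rewrite finset.setCT finset.sub0set.
  by rewrite finset.setIT cardsU1 xD Dk; lia.
have -> : D = (x |: D) :\ x.
  apply/finset.setP => y; rewrite !inE; case: eqP => [->|//] /=; exact/negbTE.
rewrite psum_setD1 ?setU11 // Hk big1 ?addr0 // => y _; exact: Hk.
Qed.

(** The index runs over all pairs of tuples, including those that no permutation realises, whose
    function is zero; the index set then has exactly |V|^(2k) elements, which bounds the
    dimension. *)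
Definition partial_matching k (q : k.-tuple V * k.-tuple V) : {perm V} -> R :=
  fun s => (uniq q.1 && (map s q.1 == q.2))%:R.

Lemma ort_level_matching k f :
  ort_level [set: V] k f <-> orthc (fun w => exists q, w = @partial_matching k q) f.
Proof.
have key (t : k.-tuple V) s : uniq t ->
    psum [set x in t] f s = dot f (partial_matching (t, map_tuple s t)).
  move=> ut; rewrite psumE; congr dot; apply/funext => s'.
  rewrite /partial_matching /= ut /=; congr (nat_of_bool _)%:R.
  apply/fixesP/eqP => [H|/eq_in_map H x].
    by apply/eq_in_map => x xt; have := H x; rewrite inE => /(_ xt); rewrite permM => /(canRL (permKV s)).
  by rewrite inE => /H; rewrite permM => ->; rewrite permK.
split=> [H _ [[t u] ->]|H D s BD].
  have [ut|nut] := boolP (uniq t); last first.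
    by rewrite /dot big1 // => s _; rewrite /partial_matching /= (negbTE nut) mulr0.
  have [[s su]|none] := pselect (exists s : {perm V}, map s t = u).
    have -> : u = map_tuple s t by apply: val_inj.
    rewrite -key // H ?finset.setCT ?finset.sub0set // finset.setIT cardsE.
    by rewrite (card_uniqP ut) size_tuple.
  rewrite /dot big1 // => s _; rewrite /partial_matching /= ut /=.
  by case: eqP => [su|_]; [case: none; exists s|rewrite mulr0].
rewrite finset.setIT => Dk.
have sz : size (enum D) == k by rewrite -cardE Dk.
have -> : D = [set x in Tuple sz] by apply/finset.setP => x; rewrite inE /= mem_enum.
by rewrite key ?enum_uniq // H //; eexists.
Qed.

(** Right translations preserve the levels, so the projections of all point masses have the same
    norm and share the trace bound equally. *)
Lemma level_projection k : exists p : {perm V} -> R,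
  [/\ ort_level [set: V] k (fun s => dirac_fun R 1%g s - p s),
      forall h, ort_level [set: V] k h -> dot h p = 0 &
      #|{perm V}|%:R * dot p p <= (N ^ k * N ^ k)%:R].
Proof.
have [P [orthP biP trP]] := projection (@partial_matching k).
have bi t h : ort_level [set: V] k h -> dot h (P t) = 0 by move/ort_level_matching/biP.
have ort t : ort_level [set: V] k (fun s => dirac_fun R t s - P t s).
  exact/ort_level_matching/orthP.
exists (P 1%g); split; [exact: ort|exact: bi|].
have trans a s : P a s = P 1%g (s * a^-1)%g.
  pose p' s := P 1%g (s * a^-1)%g.
  have p'ort : ort_level [set: V] k (fun s => dirac_fun R a s - p' s).
    have := ort_level_rtrans (a^-1)%g (ort 1%g).
    rewrite (_ : (fun s => _) = (fun s => dirac_fun R a s - p' s)) //.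
    by apply/funext => s'; rewrite /dirac_fun -eq_mulgV1.
  pose d s := (-1) * P a s + p' s.
  have dort : ort_level [set: V] k d.
    rewrite (_ : d = fun s => (-1) * (dirac_fun R a s - p' s) + (dirac_fun R a s - P a s)).
      exact: ort_levelD.
    by apply/funext => s'; rewrite /d; ring.
  have dp' : dot d p' = 0.
    pose da s := d (s * a)%g.
    rewrite -(bi 1%g da); last exact: ort_level_rtrans.
    rewrite /dot (reindex_inj (mulIg a)) /=; apply: eq_bigr => s' _.
    by rewrite /p' mulgK.
  have /dot_eq0/funeqP/(_ s) : dot d d = 0.
    by rewrite {2}/d dotDZr bi // dp' mulr0 addr0.
  by rewrite /d /p'; lra.
move: trP; rewrite card_prod !card_tuple; apply: le_trans.
rewrite le_eqVlt; apply/orP; left; apply/eqP.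
rewrite (eq_bigr (fun=> dot (P 1%g) (P 1%g))) => [|a _].
  by rewrite sumr_const mulr_natl cardT.
rewrite /dot (reindex_inj (mulIg a)) /=; apply: eq_bigr => s _.
by rewrite trans mulgK.
Qed.

End LevelProjection.

Lemma sum_geometric_le (R : realType) (q : R) n : 0 <= q -> 2 * q <= 1 ->
  \sum_(k < n) q ^+ k.+1 <= 2 * q.
Proof.
move=> q0 q1; suff : \sum_(k < n) q ^+ k.+1 <= 2 * q - 2 * q ^+ n.+1.
  by move/le_trans; apply; rewrite gerBl mulr_ge0 // exprn_ge0.
elim: n => [|n IH]; first by rewrite big_ord0 expr1 subrr.
rewrite big_ord_recr /=; have : 2 * q * q ^+ n.+1 <= 1 * q ^+ n.+1.
  by rewrite ler_wpM2r // exprn_ge0.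
rewrite [q ^+ n.+2]exprS; move: IH; move: (q ^+ n.+1) (\sum_(k < n) _) => a b; lra.
Qed.

(** * Decay of the interchange process level by level *)

Section Generator.
Variables (R : realType) (V : finType) (G : sgraph V).
Implicit Types (f h : {perm V} -> R) (s : {perm V}) (t : R).
Local Notation L := (@ip_gen R V G).
Local Notation N := #|V|.

Lemma ip_genE f s :
  L f s = (\sum_x \sum_(y | G x y) (f (tperm x y * s)%g - f s)) / 2.
Proof.
by rewrite (tperm_edges G (fun g => f (g * s)%g - f s)) mulrAC divff ?mul1r // pnatr_eq0.
Qed.

Lemma ip_gen_lin : lin L.
Proof.
move=> a f h; apply/funext => s; rewrite /ip_gen mulr_sumr -big_split.
by apply: eq_bigr => e _ /=; ring.
Qed.

Lemma dot_ip_gen f h : 2 * dot (L f) h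
  = \sum_x \sum_(y | G x y) (dot (ltrans (tperm x y) f) h - dot f h).
Proof.
rewrite /dot mulr_sumr.
transitivity (\sum_s \sum_x \sum_(y | G x y)
    ((f (tperm x y * s)%g) * h s - f s * h s)).
  apply: eq_bigr => s _; rewrite ip_genE; set Z := \sum_x _.
  have -> : 2 * (Z / 2 * h s) = Z * h s by field.
  rewrite mulr_suml; apply: eq_bigr => x _.
  by rewrite mulr_suml; apply: eq_bigr => y _; rewrite mulrBl.
rewrite exchange_big; apply: eq_bigr => x _; rewrite exchange_big /=.
by apply: eq_bigr => y _; rewrite sumrB.
Qed.

Lemma ip_gen_selfadj : selfadj L.
Proof.
move=> f h; apply: (@mulfI _ 2); first by rewrite pnatr_eq0.
rewrite [in RHS]dotC !dot_ip_gen; apply: eq_bigr => x _; apply: eq_bigr => y _.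
by rewrite (dotC h f) dot_ltrans_tperm dotC.
Qed.

Lemma dot_ip_gen_energy f :
  4 * dot (L f) f = - \sum_x \sum_(y | G x y) swap_energy f x y.
Proof.
rewrite (_ : 4 = 2 * 2) -?mulrA ?dot_ip_gen; last by rewrite -natrM.
rewrite -[RHS]mulN1r mulr_sumr [RHS]mulr_sumr; apply: eq_bigr => x _.
rewrite mulr_sumr [RHS]mulr_sumr; apply: eq_bigr => y _; rewrite swap_energyE; ring.
Qed.

Lemma ip_gen_const : L (fun=> 1) = fun=> 0.
Proof. by apply/funext => s; rewrite /ip_gen big1 // => e _; rewrite subrr. Qed.

(** Translation by a transposition moves D to a set of the same size, so a level is invariant
    whatever the graph. *)
Lemma ort_level_ip_gen k f :
  ort_level [set: V] k f -> ort_level [set: V] k (L f).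
Proof.
move=> H D s BD Dk.
suff -> : psum D (L f) s = (\sum_x \sum_(y | G x y)
    (psum (tperm x y @: D) f (tperm x y * s)%g - psum D f s)) / 2.
  rewrite big1 ?mul0r // => x _; apply: big1 => y _; rewrite (H D s) // H ?subrr //.
    by rewrite finset.setCT finset.sub0set.
  by rewrite finset.setIT card_imset -?Dk ?finset.setIT //; exact: perm_inj.
rewrite /psum; under eq_bigr do rewrite ip_genE.
rewrite -mulr_suml; congr (_ / 2).
rewrite exchange_big; apply: eq_bigr => x _; rewrite exchange_big; apply: eq_bigr => y _ /=.
rewrite sumrB; congr (_ - _).
rewrite [RHS](reindex_inj (@conjg_inj _ (tperm x y))) /=; apply: eq_big => g.
  apply/fixesP/fixesP => gD z.
    by move=> /imsetP[w wD ->]; rewrite permJ gD.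
  by move=> zD; have := gD _ (imset_f _ zD); rewrite permJ => /perm_inj.
by rewrite conjgE tpermV -!mulgA tpermKg.
Qed.

Variable C : R.
Hypothesis C_gt0 : 0 < C.
Hypothesis N_ge2 : (2 <= N)%N.
Hypothesis comparison : forall f,
  \sum_x \sum_y swap_energy f x y <= C * \sum_x \sum_(y | G x y) swap_energy f x y.

(** The 8 is the 4 of [dot_ip_gen_energy] times the 2 of [level_gap_linear]. *)
Let lam : R := N%:R / (8 * C).

Lemma ip_gen_level_gap k f : (0 < k <= N)%N -> ort_level [set: V] k.-1 f ->
  dot (L f) f <= - (lam * k%:R) * dot f f.
Proof.
move=> kN fk; have := level_gap_linear N_ge2 kN fk; have := comparison f.
have := dot_ip_gen_energy f; set E := \sum_x \sum_(y | _) _ => LE H1 H2.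
have {H1}H2 := le_trans H2 H1.
have LE' : dot (L f) f = - (E / 4) by move: LE; lra.
rewrite LE' mulNr lerN2 /lam -(ler_pM2l (_ : 0 < 8 * C)) ?mulr_gt0 //.
rewrite (_ : 8 * C * (E / 4) = 2 * (C * E)); last by field.
apply: le_trans (_ : 2 * (k%:R * N%:R / 2 * dot f f) <= _); last by rewrite ler_pM2l.
by rewrite le_eqVlt; apply/orP; left; apply/eqP; field; rewrite gt_eqF.
Qed.

Lemma ip_gen_level_decay k f t : (0 < k <= N)%N -> ort_level [set: V] k.-1 f -> 0 <= t ->
  dot (expgen L t f) (expgen L t f) <= expR (- (lam * t)) ^+ (2 * k) * dot f f.
Proof.
move=> kN fk t0.
have -> : expR (- (lam * t)) ^+ (2 * k) = expR (- (2 * (lam * k%:R)) * t).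
  by rewrite -expRM_natl natrM; congr expR; ring.
apply: (@expgen_decay _ _ _ ip_gen_lin (level_dual [set: V] k.-1)) => //.
- by move=> h /ort_levelP H; apply/ort_levelP/ort_level_ip_gen.
- by move=> h /ort_levelP H; apply: ip_gen_level_gap.
- exact/ort_levelP.
Qed.

(** With h the centred indicator of A, the deviation is the pairing of h with exp(t L) applied to
    the point mass at 1. The point mass telescopes into the increments u_k between its projections
    on levels k and k + 1, plus a level 0 part that pairs to zero. In norm u_k decays at rate lam (k
    + 1), and its squared norm is at most |V|^(2k+2) / |V|!. By Cauchy-Schwarz the |V|! cancels
    against the squared norm of h, which leaves q^(k+1). *)
Lemma ip_law_uniform A t : 0 <= t -> 2 * (N%:R * expR (- (lam * t))) <= 1 ->
  `|ip_law G t A - @uniform_law R _ A| <= 2 * (N%:R * expR (- (lam * t))).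
Proof.
move=> t0; set q := N%:R * _ => q1.
have q0 : 0 <= q by rewrite mulr_ge0 // expR_ge0.
pose P := #|{perm V}|%:R : R; have P0 : 0 < P by rewrite ltr0n; apply/card_gt0P; exists 1%g.
pose m : R := uniform_law R A.
have m01 : 0 <= m <= 1.
  rewrite /m /uniform_law divr_ge0 //= ler_pdivrMr // mul1r ler_nat.
  by rewrite -cardsT subset_leq_card //; apply/fintype.subsetP.
pose h s : R := - m * 1 + (s \in A)%:R.
have h0 : ort_level [set: V] 0 h.
  apply/ort_levelP => w [D [s [_ D0 ->]]].
  rewrite /dot (eq_bigr h) => [|s' _]; last first.
    rewrite (_ : fixes _ _) ?mulr1 //; apply/fixesP => x xD.
    by move/eqP: D0; rewrite finset.setIT cards_eq0 => /eqP D0; rewrite D0 inE in xD.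
  have indA : \sum_(s : {perm V}) (s \in A)%:R = #|A|%:R :> R.
    rewrite -sum1_card natr_sum [RHS]big_mkcond; apply: eq_bigr => s' _.
    by case: (s' \in A).
  rewrite /h big_split /= indA sumr_const -[X in X + _]mulr_natl cardT -/P /m /uniform_law.
  by rewrite -cardT -/P; field; rewrite gt_eqF.
have hP : dot h h <= P.
  have -> : P = \sum_(s : {perm V}) 1 by rewrite /P -sum1_card natr_sum.
  apply: ler_sum => s _.
  rewrite /h; case: (s \in A) => /=; move/andP: m01 => [ma mb]; nra.
have lawE : ip_law G t A - m = dot h (expgen L t (dirac_fun R 1%g)).
  rewrite -(expgen_selfadj ip_gen_lin t ip_gen_selfadj) dot_dirac /h.
  rewrite (expgen_lin ip_gen_lin t (- m) (fun=> 1) (fun s => (s \in A)%:R)).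
  rewrite (@expgen_eigen _ _ _ ip_gen_lin t 0 (fun=> 1)); last by rewrite ip_gen_const; apply/funext => ?; rewrite mul0r.
  by rewrite mul0r expR0 /ip_law /chain_law; ring.
rewrite lawE.
have /choice[p pP] := level_projection R V.
have [u uE] : exists u : nat -> {perm V} -> R, forall k s, u k s = (-1) * p k s + p k.+1 s.
  by exists (fun k s => (-1) * p k s + p k.+1 s).
(* A permutation is determined by all its coordinates, so only zero is orthogonal to level |V|. *)
have pN : p N = dirac_fun R 1%g.
  have [+ _ _] := pP N => H; apply/funext => s; apply/esym/eqP; rewrite -subr_eq0; apply/eqP.
  have BD : ~: [set: V] \subset [set: V] by exact: finset.subsetT.
  have DN : #|[set: V] :&: [set: V]| = #|[set: V]| by rewrite finset.setIT.
  rewrite -(psum_full (fun s => dirac_fun R 1%g s - p N s) s BD DN) H //.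
  by rewrite DN cardsT.
have udec n : p n = fun s => \sum_(k < n) 1 * u k s + p 0 s.
  elim: n => [|n IH]; apply/funext => s; first by rewrite big_ord0 add0r.
  by rewrite big_ord_recr /= uE IH; ring.
have uort k : (k < N)%N -> ort_level [set: V] k (u k).
  move=> kN; have [H0 _ _] := pP k; have [H1 _ _] := pP k.+1.
  have := ort_levelD (@ort_level_pred _ _ k.+1 _ kN H1) H0.
  rewrite (_ : (fun s => _) = u k) //; apply/funext => s; rewrite uE; ring.
have unorm k : (k < N)%N -> P * dot (u k) (u k) <= (N ^ k.+1 * N ^ k.+1)%:R.
  move=> kN; have [_ bi _] := pP k; have [_ _ le1] := pP k.+1.
  apply: le_trans le1; rewrite ler_pM2l //.
  have up : dot (u k) (p k) = 0 by apply: bi; exact: uort.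
  have pE : p k.+1 = fun s => 1 * u k s + p k s by apply/funext => s; rewrite uE; ring.
  rewrite pE !(dotDZl, dotDZr) (dotC (p k) (u k)) up.
  by have := dot_ge0 (p k); lra.
have term k : (k < N)%N -> `|dot h (expgen L t (u k))| <= q ^+ k.+1.
  move=> kN; rewrite -(@ler_sqr _ `|_|) ?nnegrE ?exprn_ge0 // real_normK ?num_real //.
  apply: le_trans (dot_CS _ _) _.
  have kN1 : (0 < k.+1 <= N)%N by [].
  have dec := ip_gen_level_decay kN1 (uort k kN) t0.
  apply: (@le_trans _ _ (P * (expR (- (lam * t)) ^+ (2 * k.+1) * dot (u k) (u k)))).
    by apply: ler_pM; rewrite ?dot_ge0.
  rewrite mulrCA; apply: (@le_trans _ _ (expR (- (lam * t)) ^+ (2 * k.+1) * (N ^ k.+1 * N ^ k.+1)%:R)).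
    by rewrite ler_wpM2l ?exprn_ge0 ?expR_ge0 // unorm.
  rewrite /q natrM natrX (mulnC 2) exprM exprMn le_eqVlt; apply/orP; left; apply/eqP.
  by move: (N%:R ^+ k.+1) (expR _ ^+ k.+1) => a b; ring.
have hort : ort_level [set: V] 0 (expgen L t h).
  apply/ort_levelP; apply: expgen_orthc; [exact: ip_gen_lin| |exact/ort_levelP].
  by move=> f /ort_levelP H; apply/ort_levelP/ort_level_ip_gen.
have -> : dot h (expgen L t (dirac_fun R 1%g)) = \sum_(k < N) dot h (expgen L t (u k)).
  have [_ bi _] := pP 0%N.
  rewrite -(expgen_selfadj ip_gen_lin t ip_gen_selfadj) -pN udec.
  have -> : (fun s => \sum_(k < N) 1 * u k s + p 0 s)
     = (fun s => 1 * p 0 s + \sum_(k < N) u k s).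
    by apply/funext => s; rewrite mul1r addrC; congr (_ + _); apply: eq_bigr => k _; rewrite mul1r.
  rewrite dotDZr bi // mulr0 add0r (dot_sumr _ _ (fun k : 'I_N => u k)).
  by apply: eq_bigr => k _; rewrite (expgen_selfadj ip_gen_lin t ip_gen_selfadj).
apply: le_trans (ler_norm_sum _ _ _) _; apply: le_trans (sum_geometric_le N q0 q1).
by apply: ler_sum => k _; apply: term.
Qed.

End Generator.

(** * Lower bound on the mixing time *)

(** Both bounds come from exp x >= 1 + x, at -1/2 and 1/2. That 4/9 is below 1/2 matters in
    [mixed_lower_small], where the uniform law may give the identity mass 1/2. *)
Lemma expRN1_bounds (R : realType) : 1 / 4 <= expR (- 1 : R) <= 4 / 9.
Proof.
apply/andP; split.
  have -> : - 1 = - (2^-1) + - (2^-1) :> R by field.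
  rewrite expRD; have := expR_ge1Dx (- (2^-1) : R); move: (expR _) => e; nra.
rewrite expRN -[4 / 9]invf_div lef_pV2 ?posrE ?expR_gt0 ?divr_gt0 //.
have -> : expR 1 = expR 2^-1 * expR 2^-1 :> R by rewrite -expRD; congr expR; field.
have := expR_ge1Dx (2^-1 : R); move: (expR _) => e; nra.
Qed.

Section Positivity.
Variables (R : realType) (V : finType) (G : sgraph V).
Implicit Types (f h : {perm V} -> R) (s : {perm V}) (t : R).
Local Notation L := (@ip_gen R V G).

Let Q f s : R := \sum_(e in edges G) f (edge_tperm e * s)%g.

Let lQ : lin Q.
Proof.
by move=> a f h; apply/funext => s; rewrite /Q mulr_sumr -big_split.
Qed.

(** The generator is a positive operator Q minus the number of edges, so exp(t L) f is an
    exponential factor times a series with nonnegative terms that starts with f. The factor is the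
    probability of no jump before t. *)
Lemma expgen_ip_gen_ge f t s : 0 <= t -> (forall s, 0 <= f s) ->
  expR (- (#|edges G|%:R * t)) * f s <= expgen L t f s.
Proof.
move=> t0 f0; have LE : L = fun h s => Q h s - #|edges G|%:R * h s.
  apply/funext => h; apply/funext => s'.
  by rewrite /ip_gen sumrB sumr_const mulr_natl.
have Qc h : dot (Q h) h <= #|edges G|%:R * dot h h.
  have : dot (L h) h = dot (Q h) h - #|edges G|%:R * dot h h.
    rewrite -mulNr -dotZl /dot -big_split; apply: eq_bigr => s' _ /=.
    by rewrite LE mulNr mulrBl mulNr.
  have := dot_ip_gen_energy G h.
  have : 0 <= \sum_x \sum_(y | G x y) swap_energy h x y.
    by apply: sumr_ge0 => x _; apply: sumr_ge0 => y _; exact: swap_energy_ge0.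
  lra.
rewrite LE expgen_shift // mulNr ler_wpM2l ?expR_ge0 //.
apply: expgen_ge_init => // k; elim: k => [|k IH] s' //=.
by rewrite /Q sumr_ge0.
Qed.

Lemma expgen_ip_gen_ge0 f t s : 0 <= t -> (forall s, 0 <= f s) -> 0 <= expgen L t f s.
Proof.
move=> t0 f0; apply: le_trans (expgen_ip_gen_ge s t0 f0).
by rewrite mulr_ge0 ?expR_ge0.
Qed.

Lemma expgen_ip_gen1 t : expgen L t (fun=> 1) = fun=> 1.
Proof.
rewrite (@expgen_eigen _ _ _ (ip_gen_lin G) t 0); last first.
  by rewrite ip_gen_const; apply/funext => s; rewrite mul0r.
by apply/funext => s; rewrite mul0r expR0 mul1r.
Qed.

Lemma mixed_ip_law A t : ip_mixed G t -> `|ip_law G t A - @uniform_law R _ A| <= 4 / 9.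
Proof.
move=> [t0 dt]; have /andP[_ e49] := expRN1_bounds R.
apply: le_trans (le_trans dt e49).
exact: (le_bigmax_cond _ (fun A => `|ip_law G t A - @uniform_law R _ A|)).
Qed.

(** Meant for bounded |V|: at time t the chain is still at the identity with probability at least 1
    - |E| t, the uniform law gives the identity at most 1/2, and 18 is the inverse of 1/2 - 4/9. *)
Lemma mixed_lower_small t : (2 <= #|V|)%N -> ip_mixed G t ->
  1 <= 18 * #|V|%:R ^+ 2 * t.
Proof.
move=> V2 mt; have t0 : 0 <= t by case: mt.
have := mixed_ip_law [set 1%g] mt; rewrite ler_norml => /andP[_].
rewrite /uniform_law cards1 /ip_law /chain_law.
have := @expgen_ip_gen_ge (fun s => (s \in [set 1%g])%:R) t 1%g t0 (fun s => ler0n _ _).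
rewrite inE eqxx mulr1.
have [x [y xy]] : exists x y : V, x != y.
  have /card_gt1P[x [y [_ _ xy]]] := V2; by exists x, y.
have S2 : 1 / #|{perm V}|%:R <= 1 / 2 :> R.
  rewrite !div1r lef_pV2 ?posrE ?ltr0n //; last by apply/card_gt0P; exists 1%g.
  rewrite ler_nat; apply/card_gt1P; exists 1%g, (tperm x y); split => //.
  by apply: contraNneq xy => /permP /(_ x); rewrite perm1 tpermL => ->.
have := expR_ge1Dx (- (#|edges G|%:R * t)).
have E2 : #|edges G|%:R * t <= #|V|%:R ^+ 2 * t.
  rewrite ler_wpM2r // -natrX ler_nat (leq_trans (leq_imset_card _ _)) //.
  by rewrite (leq_trans (max_card _)) // card_prod expnS expn1.
move: E2 S2; lra.
Qed.

End Positivity.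

(** * Wilson's method for an eigenfunction of the graph Laplacian *)

Section Wilson.
Variables (R : realType) (V : finType) (G : sgraph V) (g : V -> R) (gam b2 : R).
Hypothesis gam_gt0 : 0 < gam.
Hypothesis g_eig : forall x, \sum_(y | G x y) (g x - g y) = gam * g x.
Hypothesis g_bound : forall x, g x ^+ 2 <= b2.
Local Notation L := (@ip_gen R V G).
Implicit Types (s : {perm V}) (t : R).

Let F s : R := \sum_x g x * g (s x).
Let G2 : R := \sum_x g x ^+ 2.
Let V0 : R := 2 * b2 * G2.

Lemma sum_adjC (phi : V -> V -> R) :
  \sum_x \sum_(y | G x y) phi x y = \sum_x \sum_(y | G x y) phi y x.
Proof.
under eq_bigr do rewrite big_mkcond; rewrite exchange_big; apply: eq_bigr => x _ /=.
by rewrite -big_mkcond; apply: eq_bigl => y; rewrite adj_sym.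
Qed.

Lemma F_swap x y s : x != y ->
  F (tperm x y * s)%g - F s = - ((g x - g y) * (g (s x) - g (s y))).
Proof.
move=> xy; rewrite /F -sumrB (bigD1 x) //= (bigD1 y) /= 1?eq_sym // big1 => [|z /andP[zx zy]].
  by rewrite !permM tpermL tpermR; ring.
by rewrite permM tpermD 1?eq_sym // subrr.
Qed.

Lemma adj_neq x y : G x y -> x != y.
Proof. by apply: contraTneq => ->; rewrite adj_irr. Qed.

Lemma dirichlet_split (h : V -> R) :
  \sum_x \sum_(y | G x y) (g x - g y) * (h x - h y) = 2 * gam * \sum_x g x * h x.
Proof.
have E : \sum_x \sum_(y | G x y) (g x - g y) * h x = gam * \sum_x g x * h x.
  by rewrite mulr_sumr; apply: eq_bigr => x _; rewrite -mulr_suml g_eig mulrA.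
have E2 : \sum_x \sum_(y | G x y) (g x - g y) * h y = - (gam * \sum_x g x * h x).
  rewrite -E -mulN1r mulr_sumr sum_adjC; apply: eq_bigr => x _.
  by rewrite mulr_sumr; apply: eq_bigr => y _; ring.
transitivity (\sum_x (\sum_(y | G x y) (g x - g y) * h x - \sum_(y | G x y) (g x - g y) * h y)).
  by apply: eq_bigr => x _; rewrite -sumrB; apply: eq_bigr => y _; ring.
by rewrite sumrB E E2; ring.
Qed.

(** By [F_swap] a transposition changes F by minus a product of increments of g and of g composed
    with s, so L F is a Dirichlet form between these two functions, which the equation of g
    evaluates. *)
Lemma F_eigen : L F = fun s => - gam * F s.
Proof.
apply/funext => s; rewrite ip_genE.
rewrite (eq_bigr (fun x => - \sum_(y | G x y) (g x - g y) * (g (s x) - g (s y)))) => [|x _].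
  rewrite (eq_bigr (fun x => -1 * \sum_(y | G x y) (g x - g y) * (g (s x) - g (s y)))) => [|x _].
    by rewrite -mulr_sumr (dirichlet_split (fun x => g (s x))) -/(F s); field.
  by rewrite mulN1r.
by rewrite -[RHS]mulN1r mulr_sumr; apply: eq_bigr => y /adj_neq xy; rewrite F_swap // mulN1r.
Qed.

(** L (F^2) is 2 F (L F) plus half the sum of the squared increments over ordered edges, each at
    most 4 b2 (g x - g y)^2; [V0] is the value of F^2 at which this gain balances the loss. *)
Lemma F_sqr_gen s : L (fun s => F s ^+ 2) s <= - (2 * gam) * (F s ^+ 2 - V0).
Proof.
have E : L (fun s => F s ^+ 2) s = 2 * F s * L F s
    + (\sum_x \sum_(y | G x y) (F (tperm x y * s)%g - F s) ^+ 2) / 2.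
  rewrite !ip_genE mulrA -mulrDl; congr (_ / 2).
  rewrite mulr_sumr -big_split; apply: eq_bigr => x _ /=.
  by rewrite mulr_sumr -big_split; apply: eq_bigr => y _ /=; ring.
have le : \sum_x \sum_(y | G x y) (F (tperm x y * s)%g - F s) ^+ 2
    <= 4 * b2 * (2 * gam * G2).
  have -> : G2 = \sum_x g x * g x by apply: eq_bigr => x _; rewrite expr2.
  rewrite -dirichlet_split mulr_sumr; apply: ler_sum => x _.
  rewrite mulr_sumr; apply: ler_sum => y /adj_neq xy.
  rewrite F_swap // sqrrN exprMn mulrC -expr2 ler_wpM2r ?sqr_ge0 //.
  have := g_bound (s x); have := g_bound (s y); have := sqr_ge0 (g (s x) + g (s y)).
  by move: (g (s x)) (g (s y)) => a b; rewrite !expr2; nra.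
rewrite E F_eigen /V0; move: le; set Z := \sum_x _; nra.
Qed.

Let b2_ge0 (x : V) : 0 <= b2.
Proof. exact: le_trans (sqr_ge0 (g x)) (g_bound x). Qed.

(** The generator has mean zero under the uniform law, so [F_sqr_gen] can be averaged. *)
Lemma uniform_second_moment : 0 < G2 -> \sum_s F s ^+ 2 <= #|{perm V}|%:R * V0.
Proof.
move=> G20; have : \sum_s L (fun s => F s ^+ 2) s = 0.
  have := ip_gen_selfadj G (fun s => F s ^+ 2) (fun=> 1).
  rewrite ip_gen_const (dotC _ (fun=> 0)) dot0l => E; rewrite -[RHS]E.
  by apply: eq_bigr => s _; rewrite mulr1.
have : \sum_s L (fun s => F s ^+ 2) s <= \sum_s (- (2 * gam) * (F s ^+ 2 - V0)).
  by apply: ler_sum => s _; exact: F_sqr_gen.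
rewrite -mulr_sumr sumrB sumr_const -[V0 *+ _]mulr_natl.
set A := \sum_s F s ^+ 2; set B := _%:R * V0 => le eq0.
have : 0 <= (2 * gam) * (B - A) by move: le; rewrite eq0; nra.
by rewrite pmulr_rge0 ?mulr_gt0 // subr_ge0.
Qed.

Lemma second_moment t : 0 <= V0 -> 0 <= t ->
  expgen L t (fun s => F s ^+ 2) 1%g <= expR (- (2 * gam) * t) * G2 ^+ 2 + V0.
Proof.
move=> V00 t0; have lL := @ip_gen_lin R V G.
pose phi t := expgen L t (fun s => F s ^+ 2) 1%g + (- V0).
have := @gronwall _ (2 * gam) phi (fun t => expgen L t (L (fun s => F s ^+ 2)) 1%g) _ _ t t0.
rewrite /phi expgen0 //.
have -> : F 1%g = G2 by apply: eq_bigr => x _; rewrite perm1 expr2.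
move=> H; have {}H := H _ _.
suff : expgen L t (fun s => F s ^+ 2) 1%g - V0 <= expR (- (2 * gam) * t) * (G2 ^+ 2 - V0).
  by have := expR_ge0 (- (2 * gam) * t); nra.
apply: H => [t'|t' t'0].
  have := is_derive_expgen lL (fun s => F s ^+ 2) t' 1%g => D.
  by apply: (is_derive_eq (is_deriveD D (is_derive_cst (- V0) t' (1 : R)))); rewrite addr0.
pose r s := (-1) * L (fun s => F s ^+ 2) s + ((- (2 * gam)) * F s ^+ 2 + (2 * gam * V0) * 1).
have r0 : 0 <= expgen L t' r 1%g.
  by apply: expgen_ip_gen_ge0 => // s; have := F_sqr_gen s; rewrite /r; lra.
move: r0; rewrite /r (expgen_lin lL t' (-1) (L (fun s => F s ^+ 2))
  (fun s => (- (2 * gam)) * F s ^+ 2 + (2 * gam * V0) * 1)).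
rewrite (expgen_lin lL t' (- (2 * gam)) (fun s => F s ^+ 2) (fun s => (2 * gam * V0) * 1)).
rewrite (linZ (2 * gam * V0) (fun=> 1) (expgen_lin lL t')) expgen_ip_gen1; lra.
Qed.

(** Chebyshev's inequality for the event F >= m/2, where m is the mean at time t. The variance at
    time t and the uniform second moment are both at most [V0], because the initial value of F^2
    decays at the same rate as m^2. Mixing then forces (5/9) m^2 <= 8 V0, and 32 rounds up 16 times
    9/5. *)
Lemma wilson_lower t : 0 < G2 -> ip_mixed G t -> expR (- (2 * gam) * t) * G2 <= 32 * b2.
Proof.
move=> G20 mt; have t0 : 0 <= t by case: mt.
have lL := @ip_gen_lin R V G.
have [x0 _] : exists x : V, true.
  by apply/existsP; apply: contraTT G20 => /existsPn none; rewrite /G2 big1 ?ltxx // => x _;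
    have := none x.
have b20 := b2_ge0 x0.
have V00 : 0 <= V0 by rewrite /V0 !mulr_ge0 // ltW.
pose m : R := expR (- gam * t) * G2; have m0 : 0 < m by rewrite mulr_gt0 ?expR_gt0.
have m2 : m ^+ 2 = expR (- (2 * gam) * t) * G2 ^+ 2.
  by rewrite /m exprMn -expRM_natl; congr (expR _ * _); ring.
pose A := [set s | m / 2 <= F s].
have F1 : F 1%g = G2 by apply: eq_bigr => x _; rewrite perm1 expr2.
have PF : expgen L t F 1%g = m by rewrite (expgen_eigen lL t F_eigen) F1.
have PF2 := second_moment V00 t0; rewrite -m2 in PF2.
have Pvar : expgen L t (fun s => (F s - m) ^+ 2) 1%g <= V0.
  have -> : (fun s => (F s - m) ^+ 2) = (fun s => (- 2 * m) * F s + (m ^+ 2 * 1 + F s ^+ 2)).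
    by apply/funext => s; ring.
  rewrite (expgen_lin lL t (- 2 * m) F (fun s => m ^+ 2 * 1 + F s ^+ 2)).
  rewrite (expgen_lin lL t (m ^+ 2) (fun=> 1) (fun s => F s ^+ 2)) expgen_ip_gen1 PF.
  by move: PF2; rewrite !expr2; lra.
have PA : m ^+ 2 * (1 - ip_law G t A) <= 4 * V0.
  rewrite /ip_law /chain_law.
  pose r s := 4 * (F s - m) ^+ 2 + ((- m ^+ 2) * 1 + m ^+ 2 * (s \in A)%:R).
  have r0 : 0 <= expgen L t r 1%g.
    apply: expgen_ip_gen_ge0 => // s; rewrite /r inE; case: (leP (m / 2) (F s)) => FA /=.
      by have := sqr_ge0 (F s - m); lra.
    by have : (m / 2) ^+ 2 <= (m - F s) ^+ 2; [rewrite ler_sqr ?nnegrE; lra|]; nra.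
  move: r0; rewrite /r (expgen_lin lL t 4 (fun s => (F s - m) ^+ 2)
    (fun s => (- m ^+ 2) * 1 + m ^+ 2 * (s \in A)%:R)).
  rewrite (expgen_lin lL t (- m ^+ 2) (fun=> 1) (fun s => m ^+ 2 * (s \in A)%:R)).
  rewrite (linZ (m ^+ 2) (fun s => (s \in A)%:R) (expgen_lin lL t)) expgen_ip_gen1.
  by move: Pvar; lra.
pose P := #|{perm V}|%:R : R; have P0 : 0 < P by rewrite ltr0n; apply/card_gt0P; exists 1%g.
have UA : m ^+ 2 * uniform_law R A <= 4 * V0.
  rewrite /uniform_law mulrA ler_pdivrMr // -/P.
  have := uniform_second_moment G20; rewrite -/P => le.
  apply: (@le_trans _ _ (4 * \sum_s F s ^+ 2)); last by move: le; lra.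
  rewrite mulr_natr -sumr_const big_mkcond mulr_sumr; apply: ler_sum => s _ /=.
  rewrite inE; case: ifP => FA; last by rewrite mulr_ge0 ?sqr_ge0.
  have : (m / 2) ^+ 2 <= F s ^+ 2.
    by rewrite ler_sqr ?nnegrE //; [apply: divr_ge0 => //; exact: ltW|
      apply: le_trans FA; apply: divr_ge0 => //; exact: ltW].
  by nra.
have := mixed_ip_law A mt; rewrite ler_norml => /andP[_ mix].
have : m ^+ 2 * (5 / 9) <= 8 * V0.
  have : m ^+ 2 * (ip_law G t A - uniform_law R A) <= m ^+ 2 * (4 / 9).
    by rewrite ler_wpM2l // sqr_ge0.
  by move: PA UA; lra.
rewrite m2 /V0 => H.
rewrite -(ler_pM2r G20); move: H.
rewrite (_ : expR _ * G2 ^+ 2 = expR (- (2 * gam) * t) * G2 * G2); last by ring.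
move: (_ * G2 * G2) => z; have : 0 <= b2 * G2 by rewrite mulr_ge0 // ltW.
by nra.
Qed.

End Wilson.

(** The eigenfunction minimises the Rayleigh quotient orthogonally to the constants. Eigenvalue zero
    would make it constant by connectedness; the upper bound comes from (a - b)^2 <= 2 a^2 + 2 b^2
    summed over all pairs. *)
Lemma laplacian_eigen (R : realType) (X : finType) (G : sgraph X) :
  connected_graph G -> (1 < #|X|)%N ->
  exists gam (g : X -> R), [/\ 0 < gam <= 2 * #|X|%:R, g <> (fun=> 0) &
    forall a, \sum_(b | G a b) (g a - g b) = gam * g a].
Proof.
move=> conn /card_gt1P[a0 [b0 [_ _ ab0]]].
pose A (f : X -> R) a := \sum_(b | G a b) (f a - f b).
have lA : lin A.
  move=> c f h; apply/funext => a; rewrite /A mulr_sumr -big_split.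
  by apply: eq_bigr => b _ /=; ring.
have adjC := @sum_adjC R X G.
have dotA f h : 2 * dot (A f) h = \sum_a \sum_(b | G a b) (f a - f b) * (h a - h b).
  have E : dot (A f) h = \sum_a \sum_(b | G a b) (f a - f b) * h a.
    by apply: eq_bigr => a _; rewrite mulr_suml.
  have E2 : dot (A f) h = - \sum_a \sum_(b | G a b) (f a - f b) * h b.
    rewrite E adjC -[RHS]mulN1r mulr_sumr; apply: eq_bigr => a _.
    by rewrite mulr_sumr; apply: eq_bigr => b _; ring.
  rewrite mulr_natl mulr2n {1}E E2 -sumrB; apply: eq_bigr => a _.
  by rewrite -sumrB; apply: eq_bigr => b _; ring.
have sA : selfadj A.
  move=> f h; apply: (@mulfI _ 2); first by rewrite pnatr_eq0.
  rewrite (dotC f) !dotA; apply: eq_bigr => a _; apply: eq_bigr => b _.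
  by rewrite mulrC.
pose W (w : X -> R) := w = fun=> 1.
have stW f : orthc W f -> orthc W (A f).
  move=> _ w ->; rewrite sA (_ : A _ = fun=> 0) ?(dotC f) ?dot0l //.
  by apply/funext => a; rewrite /A big1 // => b _; rewrite subrr.
pose f0 (s : X) : R := dirac_fun R a0 s - dirac_fun R b0 s.
have [||gam [g [gW g0 gE _]]] := @min_eigenvector _ _ W A f0 lA sA stW.
- move=> w ->; rewrite dotC /f0.
  have -> : (fun s => dirac_fun R a0 s - dirac_fun R b0 s)
      = (fun s => (-1) * dirac_fun R b0 s + dirac_fun R a0 s).
    by apply/funext => s; ring.
  by rewrite dotDZr !dot_dirac; ring.
- move=> /funeqP/(_ a0); rewrite /f0 /dirac_fun eqxx (negbTE ab0) subr0 => /eqP.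
  by rewrite oner_eq0.
have gpos := dot_gt0 g0.
have Z : 2 * (gam * dot g g) = \sum_a \sum_(b | G a b) (g a - g b) ^+ 2.
  by rewrite -dotZl -gE dotA; apply: eq_bigr => a _; apply: eq_bigr => b _; rewrite expr2.
have Z0 : 0 <= \sum_a \sum_(b | G a b) (g a - g b) ^+ 2.
  by apply: sumr_ge0 => a _; apply: sumr_ge0 => b _; exact: sqr_ge0.
exists gam, g; split => //; last first.
  by move=> a; have /funeqP/(_ a) := gE.
apply/andP; split.
  rewrite lt_neqAle eq_sym; apply/andP; split; last first.
    by move: Z0; rewrite -Z mulrA pmulr_lge0 // pmulr_rge0.
  apply/eqP => gam0; apply: g0.
  have {}Z0 : \sum_a \sum_(b | G a b) (g a - g b) ^+ 2 = 0 by rewrite -Z gam0 mul0r mulr0.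
  have gadj a b : G a b -> g a = g b.
    move=> Gab.
    have /psumr_eq0P/(_ Z0)/(_ a isT) : forall a, true -> 0 <= \sum_(b | G a b) (g a - g b) ^+ 2.
      by move=> ? _; apply: sumr_ge0 => ? _; exact: sqr_ge0.
    move=> Za; have /psumr_eq0P/(_ Za)/(_ b Gab)/eqP : forall b, G a b -> 0 <= (g a - g b) ^+ 2.
      by move=> ? _; exact: sqr_ge0.
    by rewrite sqrf_eq0 subr_eq0 => /eqP.
  have gc a : g a = g a0.
    have /connectP[p pp ->] := conn a0 a.
    elim: p a0 {ab0 f0} pp => //= c p IH x /andP[/gadj -> /IH].
    done.
  have := gW _ erefl; rewrite /dot (eq_bigr (fun=> g a0)) => [|a _]; last by rewrite mulr1 gc.
  rewrite sumr_const => /eqP; rewrite mulrn_eq0 => /orP[|/eqP ga0].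
    by rewrite -[_ == _]negbK -lt0n; have /card_gt0P -> // : exists x, x \in X by exists a0.
  by apply/funext => a; rewrite gc.
have : \sum_a \sum_(b | G a b) (g a - g b) ^+ 2 <= \sum_a \sum_b (2 * g a ^+ 2 + 2 * g b ^+ 2).
  apply: ler_sum => a _; rewrite big_mkcond; apply: ler_sum => b _ /=.
  case: ifP => _; last by rewrite addr_ge0 // mulr_ge0 // sqr_ge0.
  by have := sqr_ge0 (g a + g b); nra.
have -> : \sum_a \sum_b (2 * g a ^+ 2 + 2 * g b ^+ 2) = 4 * #|X|%:R * dot g g.
  have cst (z : R) : \sum_(b : X) z = #|X|%:R * z by rewrite sumr_const mulr_natl.
  under eq_bigr do rewrite big_split /= cst -mulr_sumr.
  rewrite big_split /= cst -!mulr_sumr.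
  have -> : \sum_b g b ^+ 2 = dot g g by apply: eq_bigr => b _; rewrite expr2.
  by ring.
rewrite -Z mulrA ler_pM2r //; lra.
Qed.

(** * Mixing bounds for the product *)

Section Product.
Variables (R : realType) (n : nat) (X : finType) (G : 'I_n -> sgraph X).
Hypothesis n_gt0 : (0 < n)%N.
Hypothesis X_gt1 : (1 < #|X|)%N.
Hypothesis conn : forall i, connected_graph (G i).
Local Notation V := {ffun 'I_n -> X}.
Local Notation l := (#|X|%:R : R).
Local Notation N := (#|{: V}|%:R : R).

Lemma cartprod_mixed_lower (t : R) : ip_mixed (cartprod G) t ->
  N <= 32 * l * expR (4 * l * t).
Proof.
move=> mt; have t0 : 0 <= t by case: mt.
pose i0 := Ordinal n_gt0.
have [gam [g1 [/andP[gam0 gaml] g10 g1E]]] := laplacian_eigen R (conn i0) X_gt1.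
pose g (x : V) := g1 (x i0); pose D : R := \sum_a g1 a ^+ 2.
have D0 : 0 < D.
  rewrite (_ : D = dot g1 g1); first exact: dot_gt0.
  by apply: eq_bigr => a _; rewrite expr2.
have l0 : 0 < l by rewrite ltr0n ltnW.
have N0 : 0 < N by rewrite ltr0n card_ffun expn_gt0 ltnW.
(* Each value of the first coordinate is taken by a fraction 1/l of the vertices, so the sum of g^2
   is N/l times the bound D on g^2. *)
have G2E : l * \sum_x g x ^+ 2 = N * D.
  rewrite -(sum_upd i0 (fun x => g x ^+ 2)).
  rewrite (eq_bigr (fun=> D)) => [|x _]; first by rewrite sumr_const mulr_natl.
  by apply: eq_bigr => a _; rewrite /g updE.
have G20 : 0 < \sum_x g x ^+ 2 by rewrite -(pmulr_rgt0 _ l0) G2E mulr_gt0.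
have gE x : \sum_(y | cartprod G x y) (g x - g y) = gam * g x.
  rewrite (sum_cartprod G x (fun y => g x - g y)) (bigD1 i0) //= [X in _ + X]big1 ?addr0.
    by rewrite -g1E; apply: eq_bigr => b _; rewrite /g updE.
  by move=> i ii0; apply: big1 => b _; rewrite /g ffunE eq_sym (negbTE ii0) subrr.
have gb x : g x ^+ 2 <= D.
  by rewrite /D (bigD1 (x i0)) //= lerDl sumr_ge0 // => a _; exact: sqr_ge0.
have := wilson_lower gam0 gE gb G20 mt.
rewrite -(ler_pM2l l0) mulrCA G2E mulNr expRN mulrC ler_pdivrMr ?expR_gt0 // => H.
rewrite -(ler_pM2r D0); apply: (le_trans H).
have -> : l * (32 * D) * expR (2 * gam * t) = 32 * l * expR (2 * gam * t) * D by ring.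
rewrite ler_pM2r // ler_pM2l ?mulr_gt0 // ler_expR ler_wpM2r //.
by move: gaml; lra.
Qed.

Let K : R := 12 * expR 3 * 12 ^+ #|X| * #|X|%:R.

Lemma cartprod_mixed_upper : ip_mixed (cartprod G) (40 * K * ln N).
Proof.
have K0 : 0 < K by rewrite !mulr_gt0 ?expR_gt0 ?exprn_gt0 // ltr0n ltnW.
have V2 : (2 <= #|{: V}|)%N.
  by rewrite card_ffun card_ord; case: (n) n_gt0 => // k _; rewrite expnS (leq_trans X_gt1) // leq_pmulr // expn_gt0 ltnW.
have N2 : 2 <= N by rewrite ler_nat.
have N0 : 0 < N by lra.
have lnN0 : 0 <= ln N by rewrite ln_ge0 //; lra.
have t0 : 0 <= 40 * K * ln N by rewrite !mulr_ge0 // ltW.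
split=> //.
have KN0 : 0 < K * N by rewrite mulr_gt0.
have X0 : (0 < #|X|)%N by exact: ltnW.
(* The comparison constant is K N, so the rate is 1/(8K) and the exponent at this time is 5 ln N.
   This leaves N^(-4) <= 1/16, and twice that is below 1/4 <= 1/e. *)
have q : N * expR (- (N / (8 * (K * N)) * (40 * K * ln N))) <= 1 / 16.
  have -> : - (N / (8 * (K * N)) * (40 * K * ln N)) = - (5%:R * ln N).
    by field; rewrite !gt_eqF.
  rewrite expRN expRM_natl lnK ?posrE // exprS invfM mulrA divff ?gt_eqF // mul1r div1r.
  rewrite lef_pV2 ?posrE ?exprn_gt0 //.
  have -> : 16 = 2 ^+ 4 :> R by rewrite -natrX.
  by rewrite ler_pXn2r // nnegrE // ltW.
have /andP[e4 _] := expRN1_bounds R.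
apply/bigmax_leP; split; first exact: expR_ge0.
move=> A _; have q1 : 2 * (N * expR (- (N / (8 * (K * N)) * (40 * K * ln N)))) <= 1 by lra.
apply: le_trans (ip_law_uniform KN0 V2 (fun f => cartprod_comparison f n_gt0 X0 conn) A t0 q1) _.
by move: q e4; lra.
Qed.

End Product.

Theorem corollary2 (R : realType) (l : nat) (hl : (2 <= l)%N) :
  exists c C : R, [/\ 0 < c, c <= C &
    forall (n : nat) (G : 'I_n -> sgraph 'I_l),
      (1 <= n)%N -> (forall i, connected_graph (G i)) ->
      let logV := ln (#|{ffun 'I_n -> 'I_l}|%:R : R) in
      c * logV <= tmixIP R (cartprod G) /\ tmixIP R (cartprod G) <= C * logV].
Proof.
(* From |V| = K0 on, the additive term ln (32 l) of Wilson's bound is at most half of ln |V|; below,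
   |V| is bounded in terms of l. *)
pose K0 : R := (32 * l%:R) ^+ 2.
have lR : 2 <= l%:R :> R by rewrite ler_nat.
have K01 : 1 <= K0 by rewrite /K0 expr2; nra.
have K0l : 8 * l%:R <= K0 by rewrite /K0 expr2; nra.
have K3 : K0 <= K0 ^+ 3 by rewrite -[leLHS]expr1 ler_weXn2l.
have cpos : 0 < 18 * K0 ^+ 3 by lra.
pose K : R := 12 * expR 3 * 12 ^+ l * l%:R.
have K1 : 1 <= K.
  rewrite /K; have e1 : 1 <= expR 3 :> R by rewrite -expR0 ler_expR.
  have e2 : 1 <= 12 ^+ l :> R by rewrite exprn_ege1 // ler1n.
  by rewrite -!mulrA !mulr_ege1 //; lra.
(* The number 18 K0^3 dominates both 8 l, needed for large |V|, and K0 times 18 K0^2, needed for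
   small |V|. *)
exists (18 * K0 ^+ 3)^-1, (40 * K); split; first by rewrite invr_gt0.
  by apply: (@le_trans _ _ 1); [rewrite invf_le1 //|]; lra.
move=> n G n1 conn logV.
have X1 : (1 < #|'I_l|)%N by rewrite card_ord.
have up := @cartprod_mixed_upper R n _ G n1 X1 conn.
have V2 : (2 <= #|{: {ffun 'I_n -> 'I_l}}|)%N.
  by rewrite card_ffun !card_ord; case: (n) n1 => // k _; rewrite expnS (leq_trans hl) // leq_pmulr // expn_gt0 ltnW.
set N : R := #|_|%:R in logV up *.
have N2 : 2 <= N by rewrite ler_nat.
have N0 : 0 < N by lra.
have lnN0 : 0 <= logV by rewrite ln_ge0 //; lra.
split; last first.
  apply: ge_inf; first by exists 0 => u [].
  by move: up; rewrite card_ord.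
(* As [inf] is 0 on the empty set, the lower bound relies on the mixed time supplied by the upper
   bound. *)
apply: lb_le_inf; first by eexists; exact: up.
move=> t mt; have t0 : 0 <= t by case: mt.
rewrite mulrC ler_pdivrMr //.
have low := cartprod_mixed_lower n1 X1 conn mt; rewrite card_ord -/N in low.
have lnlow : logV <= ln (32 * l%:R) + 4 * l%:R * t.
  rewrite -[X in _ <= _ + X]expRK -lnM ?posrE ?expR_gt0 //; last by lra.
  by rewrite ler_ln ?posrE // mulr_gt0 ?expR_gt0 //; lra.
have [big|small] := leP (2 * ln (32 * l%:R)) logV.
  have : logV <= t * (8 * l%:R) by move: lnlow big; lra.
  move/le_trans; apply; rewrite ler_wpM2l //; lra.
have NK0 : N <= K0.
  rewrite -ler_ln ?posrE //; last lra.
  by rewrite /K0 lnXn ?mulr2n //; [move: small; rewrite /logV; lra|lra].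
have := mixed_lower_small V2 mt; rewrite -/N => s1.
have lnN : logV <= N.
  by rewrite -[leRHS]lnK ?posrE //; have := expR_ge1Dx (ln N); rewrite /logV; lra.
apply: (le_trans lnN); apply: (le_trans NK0).
have s2 : 1 <= 18 * K0 ^+ 2 * t.
  apply: (le_trans s1); rewrite ler_wpM2r // ler_pM2l //.
  by rewrite ler_pXn2r // nnegrE //; lra.
have -> : t * (18 * K0 ^+ 3) = K0 * (18 * K0 ^+ 2 * t) by ring.
by rewrite ler_peMr //; lra.
Qed.
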